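(* Fix a positive integer $m$ and put $p=\frac{2m}{m+1}$. Then the Lorentz space $\ell_{p,1}$ is the smallest symmetric Banach sequence space $X$ with $\mathrm{BH}^{\mathrm{mult}}_X(m)<\infty$, i.e. $\mathrm{BH}^{\mathrm{mult}}_{\ell_{p,1}}(m)<\infty$, and for every symmetric Banach sequence space $X$ with $\mathrm{BH}^{\mathrm{mult}}_X(m)<\infty$ one has $\ell_{p,1}\hookrightarrow X$ continuously (there is $C>0$ with $\|x\|_X\le C\|x\|_{\ell_{p,1}}$ for all $x$). Likewise, $\ell_{p,1}$ is the smallest symmetric Banach sequence space $X$ with $\mathrm{BH}^{\mathrm{pol}}_X(m)<\infty$, i.e. $\mathrm{BH}^{\mathrm{pol}}_{\ell_{p,1}}(m)<\infty$, and every symmetric Banach sequence space $X$ with $\mathrm{BH}^{\mathrm{pol}}_X(m)<\infty$ satisfies $\ell_{p,1}\hookrightarrow X$ continuously.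
   Context: A symmetric Banach sequence space $X$ is a Banach lattice of complex sequences (on $\mathbb{N}$, with counting measure) such that $x\in X$, $|y|$ and $|x|$ equidistributed imply $y\in X$ and $\|y\|_X=\|x\|_X$; for any finite or countable index set $I$ and $x=(x_i)_{i\in I}$ we set $\|x\|_X:=\|x^*\|_X$, where $x^*=(x^*_k)$ is the non-increasing rearrangement of $(|x_i|)_{i\in I}$. For $1\le p<\infty$, $1\le q<\infty$, the Lorentz space $\ell_{p,q}(I)$ consists of all $x$ with $\|x\|_{\ell_{p,q}}=\big(\sum_k (x_k^* )^q(k^{q/p}-(k-1)^{q/p})\big)^{1/q}<\infty$, and $\|x\|_{\ell_{p,\infty}}=\sup_k k^{1/p}x_k^*$. For $m,n\in\mathbb{N}$ let $\mathcal{M}(m,n)=\{\mathbf{i}=(i_1,\dots,i_m): 1\le i_k\le n\}$ and $\mathcal{J}(m,n)=\{\mathbf{j}\in\mathcal{M}(m,n): j_1\le\dots\le j_m\}$. For a complex matrix $a=(a_{\mathbf i})_{\mathbf i\in\mathcal M(m,n)}$ let $\|a\|_\infty=\sup\big|\sum_{\mathbf i\in\mathcal M(m,n)}a_{\mathbf i}x^1_{i_1}\cdots x^m_{i_m}\big|$, the sup over $x^1,\dots,x^m\in\mathbb{C}^n$ with $\|x^k\|_\infty\le1$. $\mathrm{BH}^{\mathrm{mult}}_X(m)\in[1,\infty]$ is the best constant $C\ge1$ such that $\|(a_{\mathbf i})_{\mathbf i\in\mathcal M(m,n)}\|_X\le C\|a\|_\infty$ for all $n$ and all such matrices. Every $m$-homogeneous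 polynomial on $\mathbb{C}^n$ is uniquely written $P(z)=\sum_{\mathbf j\in\mathcal J(m,n)}c_{\mathbf j}z_{j_1}\cdots z_{j_m}$; $\|P\|_\infty=\sup_{\|z\|_\infty\le1}|P(z)|$. $\mathrm{BH}^{\mathrm{pol}}_X(m)\in[1,\infty]$ is the best constant $C\ge1$ such that $\|(c_{\mathbf j})_{\mathbf j\in\mathcal J(m,n)}\|_X\le C\|P\|_\infty$ for all $n$ and all such $P$. *)

(* Defs.v *)
From HB Require Import structures.
From mathcomp Require Import all_boot all_order all_algebra.
From mathcomp Require Import all_classical all_reals.
From mathcomp Require Import ereal sequences exp.
From mathcomp Require Import complex.

Set Implicit Arguments.
Unset Strict Implicit.
Unset Printing Implicit Defensive.

Import Order.TTheory GRing.Theory Num.Theory.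
Local Open Scope classical_set_scope.
Local Open Scope ring_scope.

Section Defs.
Variable R : realType.
Local Notation C := R[i].

Definition cabs (z : C) : R := ComplexField.Normc.normc z.

Definition atleast (f : nat -> R) (l : R) (n : nat) : Prop :=
  exists s : seq nat, [/\ uniq s, size s = n & all (fun i => l < f i) s].

(** |x| and |y| equidistributed w.r.t. counting measure on nat:
    #{i : |x i| > l} = #{i : |y i| > l} (as cardinals in nat ∪ {oo})
    for every l > 0. *)
Definition equidistributed (x y : nat -> C) : Prop :=
  forall l : R, 0 < l -> forall n : nat,
    atleast (fun i => cabs (x i)) l n <-> atleast (fun i => cabs (y i)) l n.

(** A symmetric Banach sequence space X is encoded by its norm
    N : (nat -> C) -> \bar R, where N x = +oo means x \notin X. *)
Definition symmetric_banach_seq_space (N : (nat -> C) -> \bar R) : Prop :=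
  (
      (forall x, (0 <= N x)%E) /\
      (forall x, N x = 0%E -> forall i, x i = 0) /\
      (* absolute homogeneity (also gives N 0 = 0 and closure under scalars) *)
      (forall (c : C) x, N (fun i => c * x i) = ((cabs c)%:E * N x)%E) /\
      (* triangle inequality (gives closure under sums) *)
      (forall x y : nat -> C, (N (fun i => (x i + y i)%R) <= N x + N y)%E) /\
      (forall x y, (forall i, cabs (y i) <= cabs (x i)) -> (N y <= N x)%E) /\
      (forall u : nat -> nat -> C,
         (forall k, (N (u k) < +oo)%E) ->
         (forall e : R, 0 < e -> exists K, forall k l, (K <= k)%N -> (K <= l)%N ->
              (N (fun i => (u k i - u l i)%R) < e%:E)%E) ->
         exists x : nat -> C, (N x < +oo)%E /\
           (forall e : R, 0 < e -> exists K, forall k, (K <= k)%N ->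
              (N (fun i => (u k i - x i)%R) < e%:E)%E)) /\
      (forall x y, (N x < +oo)%E -> equidistributed x y -> N y = N x)).

(** norm of a finitely indexed family, given as the (duplicate-free
    enumeration of the) list of its values: ||x||_X := ||x^*||_X where
    x^* is the non-increasing rearrangement of (|x_i|), padded by zeros. *)
Definition decr_rearr_fin (s : seq C) : nat -> R :=
  fun k => nth 0 (sort (fun a b : R => b <= a) [seq cabs z | z <- s]) k.

Definition normX_fin (N : (nat -> C) -> \bar R) (s : seq C) : \bar R :=
  N (fun k => (decr_rearr_fin s k)%:C%C).

Definition nondecr (m n : nat) (j : {ffun 'I_m -> 'I_n}) : bool :=
  [forall k : 'I_m, forall l : 'I_m, (k <= l)%N ==> (j k <= j l)%N].

Definition mat_coefs (m n : nat) (a : {ffun 'I_m -> 'I_n} -> C) : seq C :=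
  [seq a i | i <- enum {ffun 'I_m -> 'I_n}].

Definition pol_coefs (m n : nat) (c : {ffun 'I_m -> 'I_n} -> C) : seq C :=
  [seq c j | j <- enum {ffun 'I_m -> 'I_n} & nondecr j].

Definition mult_sup_norm (m n : nat) (a : {ffun 'I_m -> 'I_n} -> C) : R :=
  sup [set r : R | exists x : 'I_m -> 'I_n -> C,
         (forall k j, cabs (x k j) <= 1) /\
         r = cabs (\sum_(i : {ffun 'I_m -> 'I_n}) a i * \prod_(k < m) x k (i k))].

Definition pol_sup_norm (m n : nat) (c : {ffun 'I_m -> 'I_n} -> C) : R :=
  sup [set r : R | exists z : 'I_n -> C,
         (forall j, cabs (z j) <= 1) /\
         r = cabs (\sum_(j : {ffun 'I_m -> 'I_n} | nondecr j)
                      c j * \prod_(k < m) z (j k))].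

Definition BH_mult (N : (nat -> C) -> \bar R) (m : nat) : \bar R :=
  ereal_inf [set C0%:E | C0 in [set C0 : R | 1 <= C0 /\
     forall (n : nat) (a : {ffun 'I_m -> 'I_n} -> C),
       (normX_fin N (mat_coefs a) <= (C0 * mult_sup_norm a)%:E)%E]].

Definition BH_pol (N : (nat -> C) -> \bar R) (m : nat) : \bar R :=
  ereal_inf [set C0%:E | C0 in [set C0 : R | 1 <= C0 /\
     forall (n : nat) (c : {ffun 'I_m -> 'I_n} -> C),
       (normX_fin N (pol_coefs c) <= (C0 * pol_sup_norm c)%:E)%E]].

(** non-increasing rearrangement of a sequence (0-indexed: decr_rearr x k
    is x^*_{k+1} in the paper's 1-indexed notation):
    x^*_{k+1} = inf { l >= 0 : #{i : |x i| > l} <= k } in [0, +oo] *)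
Definition decr_rearr (x : nat -> C) (k : nat) : \bar R :=
  ereal_inf [set l%:E | l in [set l : R | 0 <= l /\
                                ~ atleast (fun i => cabs (x i)) l k.+1]].

Definition lorentz_p1_norm (p : R) (x : nat -> C) : \bar R :=
  (\sum_(k <oo) (decr_rearr x k *
      ((k.+1%:R `^ p^-1) - (k%:R `^ p^-1))%:E))%E.

End Defs.

(* Main.v *)
(* The proof rests on three facts.

   Mixed norms: for a matrix [a] let [alpha_(k,i)] be the [l_2] norm of the slice [i_k = i].
   A Khinchine inequality for each of the other [m - 1] variables bounds [\sum_i alpha_(k,i)] by a
   constant times [||a||_oo].  Moreover [||a||_(p,1)] is bounded by a constant times
   [\sum_(k,i) alpha_(k,i)]: with [mu e] the least [alpha_(k, e k)] and [w] the Lorentz weight of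
   the rank of [|a e|], AM-GM gives [w |a e| <= (w ^ 2 mu e + |a e| ^ 2 / mu e) / 2]; the second
   terms sum to at most [\sum alpha], and so do the first ones up to a constant, since a product
   set [I_1 * ... * I_m] has [w ^ 2]-mass at most a constant times [\sum_k #|I_k|].

   Polarization: a polynomial comes from a multilinear form with coefficients at least as large
   on nondecreasing indices and sup norm larger by at most [m ^ m].  Hence finiteness of the
   multilinear constant implies finiteness of the polynomial one.

   Minimality: Hadamard matrices give polynomials with [2 ^ (k m)] unimodular coefficients and
   sup norm at most [2 ^ (k (m + 1) / 2)], so [X] has fundamental function at most a constant times
   [M ^ (1 / p)] at [M = 2 ^ (k m)].  Cutting a sequence at the levels [x^*_(2 ^ (k m))] and using
   completeness yields the embedding. *)
Require Import Defs.
From HB Require Import structures.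
From mathcomp Require Import all_boot all_order all_algebra.
From mathcomp Require Import fingroup perm.
From mathcomp Require Import all_classical all_reals.
From mathcomp Require Import ereal sequences exp.
From mathcomp Require Import complex.
From mathcomp Require Import normedtype.
From mathcomp Require Import ring lra.
Import Order.TTheory GRing.Theory Num.Theory.
Local Open Scope ring_scope.
Set Implicit Arguments.
Unset Strict Implicit.
Unset Printing Implicit Defensive.

(** * Lorentz weights *)

Section Weights.
Variables (R : realType) (m : nat).
Hypothesis m_gt0 : (0 < m)%N.

(** Ranks start at 0, so [k] stands for the usual rank [k + 1]; for [p > 0] the weight at 0 is 1. *)
Definition lorentz_weight (p : R) (k : nat) : R :=
  k.+1%:R `^ p^-1 - k%:R `^ p^-1.

Definition nroot (k : nat) : R := k%:R `^ m%:R^-1.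

Let p : R := (2 * m%:R) / (m%:R + 1).

Lemma nroot_ge0 k : 0 <= nroot k. Proof. exact: powR_ge0. Qed.

Lemma nroot_gt0 k : 0 < nroot k.+1. Proof. by rewrite powR_gt0. Qed.

Lemma nrootX k : nroot k ^+ m = k%:R.
Proof.
rewrite /nroot -powR_mulrn ?powR_ge0// -powRrM mulVf ?powRr1//.
by rewrite pnatr_eq0 -lt0n.
Qed.

Lemma ler_nroot k l : (k <= l)%N -> nroot k <= nroot l.
Proof.
move=> kl; apply: ge0_ler_powR; rewrite ?nnegrE ?invr_ge0 ?ler0n//.
by rewrite ler_nat.
Qed.

Lemma nroot_exp s : nroot (s ^ m) = s%:R.
Proof.
rewrite /nroot natrX -powR_mulrn// -powRrM mulfV ?powRr1//.
by rewrite pnatr_eq0 -lt0n.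
Qed.

Lemma lorentz_weight_ge0 q k : 0 <= q -> 0 <= lorentz_weight q k.
Proof.
move=> q0; rewrite subr_ge0 ge0_ler_powR ?nnegrE ?invr_ge0//.
by rewrite ler_nat.
Qed.

Lemma lorentz_exponent_gt0 : 0 < p.
Proof. by rewrite divr_gt0 ?mulr_gt0 ?ltr0n// ltr_wpDl. Qed.

Lemma lorentz_exponentV : p^-1 = (m%:R^-1 + 1) / 2.
Proof.
have m0 : m%:R != 0 :> R by rewrite pnatr_eq0 -lt0n.
have m1 : m%:R + 1 != 0 :> R by rewrite natr1 pnatr_eq0.
rewrite /p; field.
by rewrite m0 m1.
Qed.

(** Writing [x ^ q = x * x ^ (q - 1)] with [q = 1 / p <= 1] bounds the weight by
    [(k + 1) ^ (q - 1)], and [2 * (q - 1) = 1 / m - 1] is the exponent on the right. *)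
Lemma lorentz_weight_sqr k : lorentz_weight p k ^+ 2 <= (nroot k.+1 ^+ m.-1)^-1.
Proof.
have m_inv_le1 : m%:R^-1 <= 1 :> R by rewrite invf_le1 ?ltr0n// ler1n.
have pV0 : 0 < p^-1 by rewrite invr_gt0 lorentz_exponent_gt0.
have pV1 : p^-1 - 1 <= 0 by rewrite lorentz_exponentV; lra.
have k1 : k.+1%:R != 0 :> R by rewrite pnatr_eq0.
have wle : lorentz_weight p k <= k.+1%:R `^ (p^-1 - 1).
  rewrite /lorentz_weight lerBlDr -[leLHS]mulr_powRB1// -[X in _ <= _ + X]mulr_powRB1//.
  case: k k1 => [|k] k1; first by rewrite mul0r addr0 mul1r.
  suff : k.+1%:R * k.+2%:R `^ (p^-1 - 1) <= k.+1%:R * k.+1%:R `^ (p^-1 - 1) :> R.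
    by rewrite -[k.+2%:R]natr1; lra.
  rewrite ler_wpM2l// -[_ - 1]opprK !(powRN _ (- _)).
  rewrite lef_pV2 ?posrE ?powR_gt0// ge0_ler_powR ?nnegrE ?ler_nat//; lra.
have -> : (nroot k.+1 ^+ m.-1)^-1 = (k.+1%:R `^ (p^-1 - 1)) ^+ 2.
  have e : (nroot k.+1 ^+ m.-1)^-1 = nroot k.+1 / k.+1%:R.
    have <- : nroot k.+1 * nroot k.+1 ^+ m.-1 = k.+1%:R by rewrite -exprS prednK// nrootX.
    rewrite invfM mulrA mulfV ?mul1r//.
    exact: lt0r_neq0 (nroot_gt0 _).
  rewrite e -[in RHS]powR_mulrn ?powR_ge0// -powRrM.
  have -> : (p^-1 - 1) * 2 = m%:R^-1 - 1 by rewrite lorentz_exponentV; lra.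
  by rewrite powRB ?powRr1// k1 implybT.
rewrite ler_pXn2r ?nnegrE ?powR_ge0// lorentz_weight_ge0// ltW//.
exact: lorentz_exponent_gt0.
Qed.

(** Factor the difference of the [m]-th powers, which is 1, and bound each of the [m] summands by
    the [(m - 1)]-st power of the larger root. The bound telescopes over [k]. *)
Lemma nroot_increment k : (nroot k.+1 ^+ m.-1)^-1 <= m%:R * (nroot k.+1 - nroot k).
Proof.
have A0 : 0 < nroot k.+1 ^+ m.-1 by rewrite exprn_gt0 ?nroot_gt0.
have AB : nroot k <= nroot k.+1 by exact: ler_nroot.
have: nroot k.+1 ^+ m - nroot k ^+ m = 1 by rewrite !nrootX -natr1 addrAC subrr add0r.
rewrite subrXX => e.
have le : \sum_(i < m) nroot k.+1 ^+ (m.-1 - i) * nroot k ^+ i <= m%:R * nroot k.+1 ^+ m.-1.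
  have -> : m%:R * nroot k.+1 ^+ m.-1 = \sum_(i < m) nroot k.+1 ^+ m.-1.
    by rewrite sumr_const card_ord mulr_natl.
  apply: ler_sum => i _.
  have im : (i <= m.-1)%N by rewrite -ltnS prednK.
  rewrite -[in leRHS](subnK im) exprD ler_wpM2l ?exprn_ge0 ?nroot_ge0//.
  by rewrite lerXn2r ?nnegrE ?nroot_ge0.
rewrite -(ler_pM2r A0) mulVf ?gt_eqF// -[leLHS]e.
by rewrite mulrAC [leRHS]mulrC ler_wpM2l ?subr_ge0//.
Qed.

Lemma sum_nroot_pow M : \sum_(j < M) (nroot j.+1 ^+ m.-1)^-1 <= m%:R * nroot M.
Proof.
elim: M => [|M IH]; first by rewrite big_ord0 mulr_ge0 ?nroot_ge0.
rewrite big_ord_recr /=.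
have := nroot_increment M; lra.
Qed.

(** Ranks below [s ^ m] contribute at most [m * s] by telescoping. Each of the at most [s ^ m] other
    elements has squared weight at most [s ^ (1 - m)], in total at most [s]. *)
Lemma sum_inj_weight (T : finType) (S : {pred T}) (r : T -> nat) (s : nat) :
  injective r -> (#|S| <= s ^ m)%N ->
  \sum_(e in S) lorentz_weight p (r e) ^+ 2 <= (m%:R + 1) * s%:R.
Proof.
move=> r_inj cardS.
have v0 j : 0 <= (nroot j.+1 ^+ m.-1)^-1 :> R.
  by rewrite invr_ge0 exprn_ge0 ?nroot_ge0.
have [s0|s_gt0] := posnP s.
  rewrite big_pred0 ?s0 ?mulr0// => e.
  by apply/negbTE/negP => eS; move: cardS; rewrite s0 exp0n// leqNgt (cardD1 e) eS.
apply: le_trans (_ : \sum_(e in S) (nroot (r e).+1 ^+ m.-1)^-1 <= _).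
  by apply: ler_sum => e _; exact: lorentz_weight_sqr.
rewrite (bigID (fun e => r e < s ^ m)%N) /= mulrDl mul1r lerD//.
  rewrite -(nroot_exp s); apply: le_trans (sum_nroot_pow _).
  rewrite -(big_mkord xpredT (fun j => (nroot j.+1 ^+ m.-1)^-1)).
  rewrite -big_filter -(big_map r xpredT (fun j => (nroot j.+1 ^+ m.-1)^-1)).
  rewrite /index_iota subn0.
  set l := map _ _.
  have ul : uniq l by rewrite map_inj_uniq// filter_uniq// index_enum_uniq.
  have pl : perm_eq l [seq j <- iota 0 (s ^ m) | j \in l].
    apply: uniq_perm; rewrite ?filter_uniq ?iota_uniq// => j.
    rewrite mem_filter mem_iota /= add0n; case: (boolP (j \in l)) => //=.
    by move=> /mapP[e]; rewrite mem_filter => /andP[/andP[_ lt] _] ->; rewrite lt.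
  rewrite (perm_big _ pl) /= big_filter [leRHS](bigID (fun j => j \in l)) /=.
  by rewrite lerDl sumr_ge0.
apply: le_trans (_ : \sum_(e in S) (s%:R ^+ m.-1)^-1 <= _).
  rewrite [leRHS](bigID (fun e => r e < s ^ m)%N) /= -[leLHS]add0r lerD//.
    by rewrite sumr_ge0// => e _; rewrite invr_ge0 exprn_ge0.
  apply: ler_sum => e /andP[_ ge].
  rewrite lef_pV2 ?posrE ?exprn_gt0 ?nroot_gt0 ?ltr0n//.
  rewrite lerXn2r ?nnegrE ?nroot_ge0// -nroot_exp ler_nroot// ltnW// ltnS leqNgt.
  exact: ge.
rewrite sumr_const -[leLHS]mulr_natl ler_pdivrMr ?exprn_gt0 ?ltr0n//.
by rewrite -exprS prednK// -natrX ler_nat.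
Qed.

End Weights.

(** * Mixed norms dominate the Lorentz norm *)

Section Blei.
Variables (R : realType) (m n : nat).
Hypothesis m_gt0 : (0 < m)%N.
Let p : R := (2 * m%:R) / (m%:R + 1).
Let E := {ffun 'I_m -> 'I_n}.
Variable r : E -> nat.
Hypothesis r_inj : injective r.

(* Layer-cake argument: subtracting from [u] its smallest positive value on its support lowers
   both sides by controlled amounts and shrinks the support. *)
Lemma sum_weight_le_min (u : 'I_m * 'I_n -> R) (mu : E -> R) :
  (forall ki, 0 <= u ki) -> (forall e k, mu e <= u (k, e k)) ->
  \sum_e lorentz_weight p (r e) ^+ 2 * mu e <= (m%:R + 1) * \sum_ki u ki.
Proof.
move: {-1}#|_| (leqnn #|[set ki | u ki != 0]|) => N.
elim: N u mu => [|N IH] u mu leN u0 mu_le.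
  have {leN} uz ki : u ki = 0.
    apply/eqP/negPn/negP => uki; move: leN; rewrite leqn0 cards_eq0 => /eqP/setP/(_ ki).
    by rewrite !inE uki.
  (* With [u = 0] any coordinate gives [mu e <= 0]; there is one because [m > 0]. *)
  rewrite [in leRHS]big1 ?mulr0//; apply: sumr_le0 => e _.
  by rewrite mulr_ge0_le0 ?sqr_ge0// -(uz (Ordinal m_gt0, e (Ordinal m_gt0))).
have [Pz|[ki0 ki0P]] := set_0Vmem [set ki | u ki != 0].
  by apply: IH => //; rewrite Pz cards0.
set P := [set ki | u ki != 0] in leN ki0P.
have inP ki : (ki \in P) = (u ki != 0) by rewrite inE.
case: (arg_minP u ki0P) => ki1 ki1P' ki1_min.
have {ki1P'} ki1P : ki1 \in P by [].
set t := u ki1 in ki1_min.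
have t0 : 0 < t by rewrite lt_def u0 andbT -inP.
pose u' ki := u ki - t * (ki \in P)%:R.
pose S := [pred e : E | [forall k, (k, e k) \in P]].
pose mu' e := mu e - t * (e \in S)%:R.
have u'0 ki : 0 <= u' ki.
  rewrite /u'; case: (boolP (ki \in P)) => [/ki1_min|_]; last by rewrite mulr0 subr0.
  by rewrite mulr1 subr_ge0.
have mu'le e k : mu' e <= u' (k, e k).
  have [eS|eS] := boolP (e \in S).
    by rewrite /mu' /u' eS (forallP eS k) lerD2r.
  (* Off [S] some [u (l, e l)] vanishes, hence [mu e <= 0]. *)
  apply: le_trans (u'0 _); rewrite /mu' (negbTE eS) mulr0 subr0.
  move: eS; rewrite inE negb_forall => /existsP[l]; rewrite inP negbK => /eqP <-.
  exact: mu_le.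
(* The point [ki1], where the minimum is reached, leaves the support. *)
have cardP' : (#|[set ki | u' ki != 0%R]| <= N)%N.
  rewrite -ltnS (leq_trans _ leN)// proper_card//.
  apply/properP; split.
    apply/fintype.subsetP => ki; rewrite inE [in X in _ -> X]inP.
    by have [uki|//] := eqVneq (u ki) 0; rewrite /u' inP uki eqxx mulr0 subr0 eqxx.
  by exists ki1 => //; rewrite inE negbK /u' ki1P mulr1 subrr eqxx.
(* Elements of [S] take their values in the projection [U] of [P], so [sum_inj_weight] applies with
   [s = #|P|]. *)
have cardS : (#|S| <= #|P| ^ m)%N.
  pose U : {set 'I_n} := [set ki.2 | ki in P].
  apply: leq_trans (_ : #|U| ^ m <= _)%N; last by rewrite leq_exp2r ?leq_imset_card.
  rewrite -[X in (_ ^ X)%N](card_ord m) -card_ffun_on subset_leq_card//.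
  apply/fintype.subsetP => e /forallP eS; apply/ffun_onP => k.
  by apply/imsetP; exists (k, e k); rewrite ?eS.
have := IH u' mu' cardP' u'0 mu'le.
have := sum_inj_weight R m_gt0 r_inj cardS; rewrite -/p => wS.
under eq_bigr do rewrite /mu' mulrBr.
rewrite sumrB [in leRHS]sumrB mulrBr.
have -> : \sum_e lorentz_weight p (r e) ^+ 2 * (t * (e \in S)%:R) =
    t * \sum_(e in S) lorentz_weight p (r e) ^+ 2.
  rewrite mulr_sumr [RHS]big_mkcond; apply: eq_bigr => e _.
  by case: ifP => _; rewrite ?mulr1 ?mulr0// mulrC.
have -> : \sum_ki t * (ki \in P)%:R = t * #|P|%:R.
  by rewrite -mulr_sumr -sumr_const [in RHS]big_mkcond; congr (_ * _);
    apply: eq_bigr => ki _; case: ifP.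
have := ler_wpM2l (ltW t0) wS; lra.
Qed.

Lemma lorentz_le_slices (a : E -> R) (alpha : 'I_m * 'I_n -> R) :
  (forall e, 0 <= a e) -> (forall ki, 0 <= alpha ki) ->
  (forall k i, \sum_(e : E | e k == i) a e ^+ 2 <= alpha (k, i) ^+ 2) ->
  \sum_e lorentz_weight p (r e) * a e <= (m%:R + 1) * \sum_ki alpha ki.
Proof.
move=> a0 al0 a_al.
pose k0 := Ordinal m_gt0.
pose kk (e : E) := [arg min_(k < k0) alpha (k, e k)]%O.
pose mu e := alpha (kk e, e (kk e)).
have mu_le e k : mu e <= alpha (k, e k).
  by rewrite /mu /kk; case: arg_minP => // l _; apply.
have a_le_al e k : a e ^+ 2 <= alpha (k, e k) ^+ 2.
  apply: le_trans (a_al k (e k)); rewrite (bigD1 e)//= lerDl sumr_ge0// => *.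
  exact: sqr_ge0.
have H1 := sum_weight_le_min al0 mu_le.
(* Add the other coordinates to the minimizing one, then group by the value [i] of [e k]: a slice
   contributes at most [alpha (k, i) ^ 2 / alpha (k, i)]. *)
have H2 : \sum_e a e ^+ 2 / mu e <= \sum_ki alpha ki.
  apply: le_trans (_ : \sum_e \sum_k a e ^+ 2 / alpha (k, e k) <= _).
    apply: ler_sum => e _; rewrite (bigD1 (kk e))//= lerDl sumr_ge0// => k _.
    by rewrite divr_ge0 ?sqr_ge0.
  have -> : \sum_ki alpha ki = \sum_k \sum_i alpha (k, i).
    by rewrite pair_bigA; apply: eq_bigr => -[].
  rewrite exchange_big /=.
  apply: ler_sum => k _.
  rewrite (partition_big (fun e : E => e k) xpredT)//=.
  apply: ler_sum => i _.
  under eq_bigr => e /eqP-> do [].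
  rewrite -mulr_suml; have [->|alN0] := eqVneq (alpha (k, i)) 0.
    by rewrite invr0 mulr0.
  have al_gt0 : 0 < alpha (k, i) by rewrite lt_def alN0 al0.
  by rewrite ler_pdivrMr// -expr2.
have H3 e : lorentz_weight p (r e) * a e <=
    2^-1 * (lorentz_weight p (r e) ^+ 2 * mu e + a e ^+ 2 / mu e).
  (* As the inverse of 0 is 0, the case [mu e = 0] requires [a e = 0], which the slice bound
     provides. *)
  have [mu0|muN0] := eqVneq (mu e) 0.
    have -> : a e = 0.
      apply/eqP; rewrite -sqrf_eq0 eq_le sqr_ge0 andbT.
      by have := a_le_al e (kk e); rewrite -/(mu e) mu0 expr0n.
    by rewrite mu0 expr0n /= mul0r !mulr0 addr0 mulr0.
  have mu_gt0 : 0 < mu e by rewrite lt_def muN0 al0.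
  rewrite -(ler_pM2r mu_gt0) -subr_ge0.
  have -> : 2^-1 * (lorentz_weight p (r e) ^+ 2 * mu e + a e ^+ 2 / mu e) * mu e -
     lorentz_weight p (r e) * a e * mu e = 2^-1 * (lorentz_weight p (r e) * mu e - a e) ^+ 2.
    by field.
  by rewrite mulr_ge0 ?sqr_ge0.
apply: (le_trans (ler_sum _ (fun e _ => H3 e))).
rewrite -mulr_sumr big_split /=.
have m1 : 1 <= m%:R :> R by rewrite ler1n.
have al_ge0 : 0 <= \sum_ki alpha ki by rewrite sumr_ge0.
nra.
Qed.

End Blei.

(** * Khinchine inequalities *)

Section Insert.
Variables (J : finType) (m : nat).

Definition ffun_insert (k0 : 'I_m.+1) (j : J) (g : {ffun 'I_m -> J}) :
    {ffun 'I_m.+1 -> J} :=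
  [ffun k => if unlift k0 k is Some k' then g k' else j].

Lemma ffun_insert_id k0 j g : ffun_insert k0 j g k0 = j.
Proof. by rewrite ffunE unlift_none. Qed.

Lemma ffun_insert_lift k0 j g k : ffun_insert k0 j g (lift k0 k) = g k.
Proof. by rewrite ffunE liftK. Qed.

Lemma big_ffun_insert (V : nmodType) k0 (F : {ffun 'I_m.+1 -> J} -> V) :
  \sum_f F f = \sum_j \sum_g F (ffun_insert k0 j g).
Proof.
rewrite pair_bigA /=.
rewrite (reindex (fun jg => ffun_insert k0 jg.1 jg.2))//=.
exists (fun f => (f k0, [ffun k => f (lift k0 k)])) => [[j g]|f] _ /=.
  by rewrite ffun_insert_id; congr (_, _); apply/ffunP => k; rewrite ffunE ffun_insert_lift.
apply/ffunP => k; rewrite ffunE.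
by case: unliftP => [l|] ->; rewrite ?ffunE.
Qed.

Lemma big_ffun_slice (V : nmodType) k0 j (F : {ffun 'I_m.+1 -> J} -> V) :
  \sum_(f : {ffun 'I_m.+1 -> J} | f k0 == j) F f = \sum_g F (ffun_insert k0 j g).
Proof.
rewrite big_mkcond (big_ffun_insert k0) (bigD1 j)//= [X in _ + X]big1 ?addr0.
  by apply: eq_bigr => g _; rewrite ffun_insert_id eqxx.
by move=> l lj; apply: big1 => g _; rewrite ffun_insert_id (negbTE lj).
Qed.

Lemma prod_ffun_insert (A : comNzRingType) k0 j g (x : 'I_m.+1 -> J -> A) :
  \prod_k x k (ffun_insert k0 j g k) = x k0 j * \prod_k x (lift k0 k) (g k).
Proof.
rewrite (bigD1_ord k0)//= ffun_insert_id; congr (_ * _).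
by apply: eq_bigr => k _; rewrite ffun_insert_lift.
Qed.

End Insert.

Section Khinchine.
Variable R : realType.

Definition is_sign (x : R) := (x == 1) || (x == -1).

(** Cauchy-Schwarz, from the nonnegative quadratic form [\sum_t (x * u t + y * v t) ^+ 2] at
    [x = b], [y = - r]. *)
Lemma sqr_sum_le (T : finType) (u v : T -> R) :
  (\sum_t u t * v t) ^+ 2 <= (\sum_t u t ^+ 2) * (\sum_t v t ^+ 2).
Proof.
set r := \sum_t _; set a := \sum_t _; set b := \sum_t _.
have b0 : 0 <= b by rewrite sumr_ge0// => t _; exact: sqr_ge0.
have e x y : \sum_t (x * u t + y * v t) ^+ 2 = x ^+ 2 * a + 2 * x * y * r + y ^+ 2 * b.
  rewrite /a /b /r !mulr_sumr -!big_split /=; apply: eq_bigr => t _; ring.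
have pos x y : 0 <= x ^+ 2 * a + 2 * x * y * r + y ^+ 2 * b.
  by rewrite -e sumr_ge0// => t _; exact: sqr_ge0.
have := pos b (- r); have := pos r (- (a + 1) / 2).
(* If [b = 0], the form at [x = r], [y = - (a + 1) / 2] equals [- r ^ 2], which forces [r = 0]. *)
have [b_eq0|bN0] := eqVneq b 0.
  have := pos 1 (- r * (a + 1)); have := pos 0 1; rewrite b_eq0.
  have a0 : 0 <= a by rewrite sumr_ge0// => t _; exact: sqr_ge0.
  nra.
have b_gt0 : 0 < b by rewrite lt_def bN0.
move=> _ H; rewrite -subr_ge0 -(pmulr_rge0 _ b_gt0).
have -> : b * (a * b - r ^+ 2) = b ^+ 2 * a + 2 * b * - r * r + (- r) ^+ 2 * b by ring.
exact: H.
Qed.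

(* Khinchine's inequality derandomized: the bracket is a lower bound for the conditional
   expectation of the right-hand side given the partial sums [u], by the fourth moment estimate
   [E |u + S| ^ 4 <= |u| ^ 4 + 6 |u| ^ 2 s + 3 s ^ 2] where [s = E |S| ^ 2]. *)
Lemma sign_choice (I J T : finType) (v : J -> I -> T -> R) (al be : I -> R)
    (js : seq J) (u : I -> T -> R) : (forall i, 0 <= be i) -> uniq js ->
  let sq (w : T -> R) := \sum_t w t ^+ 2 in
  let s i := \sum_(j <- js) sq (v j i) in
  exists eps : J -> R, (forall j, is_sign (eps j)) /\
    \sum_i (al i * (sq (u i) + s i)
            - be i * (sq (u i) ^+ 2 + 6 * sq (u i) * s i + 3 * s i ^+ 2))
    <= \sum_i (al i * sq (fun t => u i t + \sum_(j <- js) eps j * v j i t)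
               - be i * sq (fun t => u i t + \sum_(j <- js) eps j * v j i t) ^+ 2).
Proof.
move=> be0 + sq; elim: js u => [|j js IH] u /=.
  move=> _; exists (fun=> 1); split; first by move=> j; rewrite /is_sign eqxx.
  apply: ler_sum => i _; rewrite big_nil.
  have -> : sq (fun t => u i t + \sum_(j <- [::]) 1 * v j i t) = sq (u i).
    by apply: eq_bigr => t _; rewrite big_nil addr0.
  by rewrite expr0n /= !mulr0 !addr0.
move=> /andP[jjs ujs].
pose s i := \sum_(j <- js) sq (v j i).
have s0 i : 0 <= s i.
  by rewrite /s sumr_ge0// => l _; rewrite sumr_ge0// => t _; exact: sqr_ge0.
pose Phi (w : I -> T -> R) := \sum_i (al i * (sq (w i) + s i)
            - be i * (sq (w i) ^+ 2 + 6 * sq (w i) * s i + 3 * s i ^+ 2)).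
pose w c i t := u i t + c * v j i t.
pose L := \sum_i (al i * (sq (u i) + (sq (v j i) + s i))
    - be i * (sq (u i) ^+ 2 + 6 * sq (u i) * (sq (v j i) + s i) + 3 * (sq (v j i) + s i) ^+ 2)).
(* A sign [c] for [j] that preserves the lower bound suffices: the induction hypothesis, started at
   [w c], gives the other signs. *)
suff [c [c1 cle]] : exists c : R, is_sign c /\ L <= Phi (w c).
  have [eps [eps1 epsle]] := IH (w c) ujs.
  exists (fun l => if l == j then c else eps l); split.
    by move=> l; case: ifP.
  under eq_bigr do rewrite big_cons.
  apply: (le_trans cle); apply: (le_trans epsle).
  have eqw i : sq (fun t => w c i t + \sum_(l <- js) eps l * v l i t) =
      sq (fun t => u i t + \sum_(l <- j :: js) (if l == j then c else eps l) * v l i t).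
    apply: eq_bigr => t _; rewrite big_cons eqxx addrA; congr ((_ + _) ^+ 2).
    apply: eq_big_seq => l ljs; case: eqP => // lj.
    by move: jjs; rewrite -lj ljs.
  by apply: ler_sum => i _; rewrite eqw.
(* If the average over both signs is at least [L], so is the value at one of them. *)
suff : 2 * L <= Phi (w 1) + Phi (w (-1)).
  have [h|h] := leP L (Phi (w 1)); first by exists 1; rewrite /is_sign eqxx.
  exists (-1); rewrite /is_sign eqxx orbT; split => //; lra.
rewrite mulr_sumr -big_split /=; apply: ler_sum => i _.
pose r := \sum_t u i t * v j i t.
have sqw c : sq (w c i) = sq (u i) + 2 * c * r + c ^+ 2 * sq (v j i).
  by rewrite /sq /r !mulr_sumr -!big_split /=; apply: eq_bigr => t _; rewrite /w; ring.
have CS : r ^+ 2 <= sq (u i) * sq (v j i) by exact: sqr_sum_le.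
rewrite !sqw -subr_ge0.
set a := sq (u i) in CS *; set b := sq (v j i) in CS *.
rewrite (_ : _ - _ = be i * (8 * (a * b - r ^+ 2) + 4 * b ^+ 2)); last by ring.
by rewrite mulr_ge0//; have := sqr_ge0 b; lra.
Qed.

(** For [y, t >= 0], the inequality [z - z ^ 3 / 4 <= 1] at [z = y * t] gives
    [y * t ^ 2 - y ^ 3 * t ^ 4 / 4 <= t]. This trades a norm [t] for the second and fourth powers
    that [sign_choice] controls. *)
Lemma khinchine_sign_choice (I J T : finType) (v : J -> I -> T -> R) :
  exists eps : J -> R, (forall j, is_sign (eps j)) /\
    \sum_i Num.sqrt (\sum_j \sum_t v j i t ^+ 2) <=
    3 * \sum_i Num.sqrt (\sum_t (\sum_j eps j * v j i t) ^+ 2).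
Proof.
pose s i := \sum_j \sum_t v j i t ^+ 2.
have s0 i : 0 <= s i by rewrite !sumr_ge0// => j _; rewrite sumr_ge0// => t _; exact: sqr_ge0.
(* With [q = Num.sqrt (s i)], this scale makes the lower bound [q / 2 - 3 * q / 32 = 13 * q / 32],
   which is at least [q / 3]; hence the constant 3. *)
pose y i := (2 * Num.sqrt (s i))^-1.
have y0 i : 0 <= y i by rewrite invr_ge0 mulr_ge0 ?sqrtr_ge0.
have be0 i : 0 <= y i ^+ 3 / 4 by rewrite divr_ge0 ?exprn_ge0.
have [eps [eps1 H]] := sign_choice v y (fun _ _ => 0) be0 (index_enum_uniq J).
exists eps; split => //.
rewrite -ler_pdivrMl// mulr_sumr.
have z0 : \sum_(t : T) (0 : R) ^+ 2 = 0 by rewrite big1// => t _; rewrite expr0n.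
apply: le_trans (le_trans _ H) _.
  apply: ler_sum => i _; rewrite z0 !(add0r, mul0r, mulr0) expr0n /= add0r -/(s i).
  have [si0|siN0] := eqVneq (s i) 0.
    by rewrite si0 sqrtr0 expr0n /= !(mulr0, addr0, subr0).
  have q0 : 0 < Num.sqrt (s i) by rewrite sqrtr_gt0 lt_def siN0 s0.
  rewrite -{2 3}(sqr_sqrtr (s0 i)) /y; set q := Num.sqrt _ in q0 *.
  rewrite -subr_ge0 (_ : _ - _ = q * (13 / 32 - 1 / 3)); first by rewrite mulr_ge0 ?ltW//; lra.
  by field; rewrite gt_eqF.
apply: ler_sum => i _.
under eq_bigr do rewrite add0r.
set X := \sum_t _.
have X0 : 0 <= X by rewrite sumr_ge0// => t _; exact: sqr_ge0.
rewrite -(sqr_sqrtr X0) sqrtr_sqr ger0_norm ?sqrtr_ge0//.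
have := sqrtr_ge0 X; set t := Num.sqrt X; move=> t0.
have qle : y i * t - (y i * t) ^+ 3 / 4 <= 1.
  have := mulr_ge0 (y0 i) t0; set q := y i * t => q0.
  have : 0 <= (q - 1) ^+ 2 * (q + 2) by rewrite mulr_ge0 ?sqr_ge0 ?addr_ge0.
  nra.
have := ler_wpM2l t0 qle; rewrite mulr1; apply: le_trans.
by rewrite le_eqVlt; apply/orP; left; apply/eqP; field.
Qed.

(** Induction on [m]: [khinchine_sign_choice], with the remaining multi-indices as [T], fixes the
    signs of the first variable at the cost of a factor 3; the induction hypothesis treats the
    coefficients summed over that variable. *)
Lemma multiple_khinchine (J : finType) m (I : finType) (a : I -> {ffun 'I_m -> J} -> R) :
  exists x : 'I_m -> J -> R, (forall k j, is_sign (x k j)) /\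
    \sum_i Num.sqrt (\sum_g a i g ^+ 2) <=
    3 ^+ m * \sum_i `|\sum_g a i g * \prod_k x k (g k)|.
Proof.
elim: m a => [|m IH] a.
  exists (fun _ _ => 1); split; first by move=> *; rewrite /is_sign eqxx.
  rewrite expr0 mul1r; apply: ler_sum => i _.
  pose g0 : {ffun 'I_0 -> J} := ffun0 (card_ord 0).
  have u (F : {ffun 'I_0 -> J} -> R) : \sum_g F g = F g0.
    rewrite (bigD1 g0)//= big1 ?addr0// => g /eqP; case.
    by apply/ffunP => -[].
  by rewrite !u big_ord0 mulr1 sqrtr_sqr.
have [eps [eps1 H]] := khinchine_sign_choice
  (fun j i (g : {ffun 'I_m -> J}) => a i (ffun_insert ord0 j g)).
have [x [x1 Hx]] := IH (fun i g => \sum_j eps j * a i (ffun_insert ord0 j g)).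
pose x' k j := if unlift ord0 k is Some k' then x k' j else eps j.
exists x'; split; first by move=> k j; rewrite /x'; case: unliftP.
under eq_bigr do rewrite (big_ffun_insert ord0).
apply: (le_trans H); rewrite exprS -mulrA ler_wpM2l//.
apply: (le_trans Hx); rewrite ler_wpM2l ?exprn_ge0//.
rewrite le_eqVlt; apply/orP; left; apply/eqP; apply: eq_bigr => i _; congr `|_|.
rewrite (big_ffun_insert ord0) exchange_big /=; apply: eq_bigr => g _.
rewrite mulr_suml; apply: eq_bigr => j _.
rewrite (prod_ffun_insert ord0 j g x') /x' unlift_none.
under [in RHS]eq_bigr do rewrite liftK.
by ring.
Qed.

End Khinchine.

(** * Sup norms and mixed norms *)

Section Modulus.
Variable R : realType.
Local Notation C := R[i].

Lemma cabs_ge0 (z : C) : 0 <= cabs z.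
Proof. by case: z => x y; exact: sqrtr_ge0. Qed.

Lemma cabs_sqr (z : C) : cabs z ^+ 2 = complex.Re z ^+ 2 + complex.Im z ^+ 2.
Proof. by case: z => x y; rewrite sqr_sqrtr// addr_ge0 ?sqr_ge0. Qed.

Lemma cabs0 : cabs (0 : C) = 0. Proof. exact: ComplexField.Normc.normc0. Qed.

Lemma cabs1 : cabs (1 : C) = 1. Proof. exact: ComplexField.Normc.normc1. Qed.

Lemma cabsM (x y : C) : cabs (x * y) = cabs x * cabs y.
Proof. exact: ComplexField.Normc.normcM. Qed.

Lemma cabsN (x : C) : cabs (- x) = cabs x.
Proof. exact: normcN. Qed.

Lemma cabsD (x y : C) : cabs (x + y) <= cabs x + cabs y.
Proof. exact: le_normcD. Qed.

Lemma cabs_real (x : R) : cabs x%:C%C = `|x|.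
Proof. by rewrite /cabs /= expr0n /= addr0 sqrtr_sqr. Qed.

Lemma cabs_eq0 (z : C) : (cabs z == 0) = (z == 0).
Proof.
apply/eqP/eqP => [|->]; last exact: cabs0.
exact: ComplexField.Normc.eq0_normc.
Qed.

Lemma cabs_nat (k : nat) : cabs (k%:R : C) = k%:R.
Proof. by rewrite -(rmorph_nat (real_complex R)) cabs_real ger0_norm. Qed.

Lemma cabs_prod (I : finType) (F : I -> C) : cabs (\prod_i F i) = \prod_i cabs (F i).
Proof. by elim/big_rec2: _ => [|i y x _ <-]; rewrite ?cabs1 ?cabsM. Qed.

Lemma cabs_sum (I : finType) (P : pred I) (F : I -> C) :
  cabs (\sum_(i | P i) F i) <= \sum_(i | P i) cabs (F i).
Proof.
elim/big_rec2: _ => [|i y x _ h]; first by rewrite cabs0.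
by apply: (le_trans (cabsD _ _)); rewrite lerD2l.
Qed.

Lemma Re_le_cabs (z : C) : `|complex.Re z| <= cabs z.
Proof.
rewrite -(@ler_pXn2r _ 2)// ?nnegrE ?cabs_ge0//.
by rewrite cabs_sqr real_normK ?num_real// lerDl sqr_ge0.
Qed.

Lemma Im_le_cabs (z : C) : `|complex.Im z| <= cabs z.
Proof.
rewrite -(@ler_pXn2r _ 2)// ?nnegrE ?cabs_ge0//.
by rewrite cabs_sqr real_normK ?num_real// lerDr sqr_ge0.
Qed.

Lemma cabs_prod_le1 (I : finType) (F : I -> C) :
  (forall i, cabs (F i) <= 1) -> cabs (\prod_i F i) <= 1.
Proof.
move=> F1; elim/big_rec: _ => [|i x _ x1]; first by rewrite cabs1.
by rewrite cabsM mulr_ile1 ?cabs_ge0.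
Qed.

Lemma cabs_sign (x : R) : is_sign x -> cabs x%:C%C = 1.
Proof. by move=> /orP[]/eqP->; rewrite cabs_real ?normrN normr1. Qed.

End Modulus.

Section SupNorm.
Local Open Scope classical_set_scope.
Variables (R : realType) (m n : nat).
Local Notation C := R[i].
Implicit Type a : {ffun 'I_m -> 'I_n} -> C.

Lemma mult_form_le (a : {ffun 'I_m -> 'I_n} -> C) (x : 'I_m -> 'I_n -> C) :
  (forall k j, cabs (x k j) <= 1) ->
  cabs (\sum_i a i * \prod_(k < m) x k (i k)) <= mult_sup_norm a.
Proof.
move=> x1; apply: sup_upper_bound; last by exists x.
split; first by exists (cabs (\sum_i a i * \prod_(k < m) x k (i k))), x.
exists (\sum_i cabs (a i)) => _ [y [y1 ->]].
apply: (le_trans (cabs_sum _ _)); apply: ler_sum => i _.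
by rewrite cabsM ler_piMr ?cabs_ge0// cabs_prod_le1.
Qed.

Lemma mult_sup_norm_ge0 a : 0 <= mult_sup_norm a.
Proof.
apply: le_trans (cabs_ge0 _) (mult_form_le a (x := fun _ _ => 0) _) => k j.
by rewrite cabs0.
Qed.

Lemma mult_sup_norm_le a (B : R) :
  (forall x : 'I_m -> 'I_n -> C, (forall k j, cabs (x k j) <= 1) ->
     cabs (\sum_i a i * \prod_(k < m) x k (i k)) <= B) ->
  mult_sup_norm a <= B.
Proof.
move=> H; apply: ge_sup => [|_ [x [x1 ->]]]; last exact: H.
by exists (cabs (\sum_i a i * \prod_(k < m) 0)), (fun _ _ => 0); split => // *; rewrite cabs0.
Qed.

Lemma poly_le (c : {ffun 'I_m -> 'I_n} -> C) (z : 'I_n -> C) :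
  (forall j, cabs (z j) <= 1) ->
  cabs (\sum_(j : {ffun 'I_m -> 'I_n} | nondecr j) c j * \prod_(k < m) z (j k))
    <= pol_sup_norm c.
Proof.
move=> z1; apply: sup_upper_bound; last by exists z.
split; first by eexists; exists z.
exists (\sum_(j : {ffun 'I_m -> 'I_n} | nondecr j) cabs (c j)) => _ [y [y1 ->]].
apply: (le_trans (cabs_sum _ _)); apply: ler_sum => i _.
by rewrite cabsM ler_piMr ?cabs_ge0// cabs_prod_le1.
Qed.

Lemma pol_sup_norm_le c (B : R) :
  (forall z : 'I_n -> C, (forall j, cabs (z j) <= 1) ->
     cabs (\sum_(j : {ffun 'I_m -> 'I_n} | nondecr j) c j * \prod_(k < m) z (j k)) <= B) ->
  pol_sup_norm c <= B.
Proof.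
move=> H; apply: ge_sup => [|_ [x [x1 ->]]]; last exact: H.
by eexists; exists (fun _ => 0); split => // *; rewrite cabs0.
Qed.

End SupNorm.

(** * Slice norms against the sup norm of the form *)

Section Slices.
Variables (R : realType) (m n : nat).
Local Notation C := R[i].

(** Meant for [h] the real or imaginary part. [multiple_khinchine] gives signs for all variables but
    the one at [k0]; that one receives the signs of the resulting sums [S i], so that the sum of
    their absolute values is [h] of a value of the form. *)
Lemma slice_norms_le (h : C -> R) (a : {ffun 'I_m.+1 -> 'I_n} -> C) k0 :
  (forall x y, h (x + y) = h x + h y) ->
  (forall (r : R) z, h (r%:C%C * z) = r * h z) ->
  (forall z, `|h z| <= cabs z) ->
  \sum_i Num.sqrt (\sum_(e : {ffun 'I_m.+1 -> 'I_n} | e k0 == i) h (a e) ^+ 2)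
    <= 3 ^+ m * mult_sup_norm a.
Proof.
move=> hD hZ h_le.
have h0 : h 0 = 0 by have := hZ 0 0; rewrite mulr0 mul0r.
have h_sum (I : finType) (F : I -> C) : h (\sum_i F i) = \sum_i h (F i).
  exact: (big_morph h hD h0).
under eq_bigr do rewrite big_ffun_slice.
have [x [x1 H]] := multiple_khinchine (fun i g => h (a (ffun_insert k0 i g))).
apply: (le_trans H); rewrite ler_wpM2l ?exprn_ge0//.
pose S i := \sum_g h (a (ffun_insert k0 i g)) * \prod_k x k (g k).
pose s i : R := if 0 <= S i then 1 else -1.
have sS i : s i * S i = `|S i|.
  by rewrite /s; case: ger0P => _; rewrite ?mul1r ?mulN1r.
pose z k j : C := (if unlift k0 k is Some k' then x k' j else s j)%:C%C.
have z1 k j : cabs (z k j) <= 1.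
  rewrite cabs_sign// /z; case: unliftP => [k' _|_]; first exact: x1.
  by rewrite /s /is_sign; case: ifP; rewrite eqxx ?orbT.
apply: le_trans (mult_form_le a z1); apply: le_trans (h_le _).
apply: le_trans (ler_norm _).
rewrite (big_ffun_insert k0) h_sum.
rewrite le_eqVlt; apply/orP; left; apply/eqP; apply: eq_bigr => i _.
rewrite -/(S i) -sS /S h_sum mulr_sumr; apply: eq_bigr => g _.
rewrite (prod_ffun_insert k0 i g z) /z unlift_none.
under [in RHS]eq_bigr do rewrite liftK.
rewrite -rmorph_prod -rmorphM [in RHS]mulrC hZ /=; ring.
Qed.

(** Here [alpha] adds the slice norms of the real and imaginary parts, whence the factor 2; the
    factor [m.+1%:R] counts the positions of a slice, and [m.+1%:R + 1] comes from
    [lorentz_le_slices]. *)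
Lemma mixed_norms_le (a : {ffun 'I_m.+1 -> 'I_n} -> C) r : injective r ->
  \sum_e lorentz_weight ((2 * m.+1%:R) / (m.+1%:R + 1)) (r e) * cabs (a e) <=
  (m.+1%:R + 1) * (m.+1%:R * 2 * 3 ^+ m) * mult_sup_norm a.
Proof.
move=> r_inj.
pose al (h : C -> R) (ki : 'I_m.+1 * 'I_n) :=
  Num.sqrt (\sum_(e : {ffun 'I_m.+1 -> 'I_n} | e ki.1 == ki.2) h (a e) ^+ 2).
have al0 h ki : 0 <= al h ki by exact: sqrtr_ge0.
have sum_al h : (forall x y, h (x + y) = h x + h y) ->
    (forall (r : R) z, h (r%:C%C * z) = r * h z) -> (forall z, `|h z| <= cabs z) ->
    \sum_ki al h ki <= m.+1%:R * (3 ^+ m * mult_sup_norm a).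
  move=> hD hZ h_le.
  have -> : \sum_ki al h ki = \sum_k \sum_i al h (k, i).
    by rewrite pair_bigA; apply: eq_bigr => -[].
  rewrite -[X in X%:R](card_ord m.+1) mulr_natl -sumr_const.
  by apply: ler_sum => k _; exact: slice_norms_le.
have HRe := sum_al (@complex.Re R).
have HIm := sum_al (@complex.Im R).
apply: le_trans (lorentz_le_slices (ltn0Sn m) r_inj
  (alpha := fun ki => al (@complex.Re R) ki + al (@complex.Im R) ki) _ _ _) _.
- by move=> e; exact: cabs_ge0.
- by move=> ki; rewrite addr_ge0.
- move=> k i; under eq_bigr do rewrite cabs_sqr.
  rewrite big_split /= sqrrD !sqr_sqrtr ?sumr_ge0//; try by move=> *; exact: sqr_ge0.
  by rewrite addrAC lerDl mulrn_wge0// mulr_ge0.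
rewrite -mulrA ler_wpM2l// big_split /=.

apply: le_trans (lerD (HRe _ _ _) (HIm _ _ _)) _.
- by case=> ? ? [].
- by move=> r0 [x y] /=; rewrite mul0r subr0.
- exact: Re_le_cabs.
- by case=> ? ? [].
- by move=> r0 [x y] /=; rewrite mul0r addr0.
- exact: Im_le_cabs.
by rewrite le_eqVlt; apply/orP; left; apply/eqP; ring.
Qed.

End Slices.

(** * Decreasing rearrangements *)

Section Rearrangement.
Variable R : realType.
Local Notation C := R[i].

(** The rearrangement is inverse to the distribution function, which reduces comparisons to
    counting. The default 0 beyond the list accounts for [0 <= t]. *)
Lemma nth_sort_ge_le (l : seq R) (t : R) k : 0 <= t ->
  (nth 0 (sort (fun a b : R => b <= a) l) k <= t) = (count (fun y => (t < y)%R) l <= k)%N.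
Proof.
move=> t0; have sp : perm_eq (sort (fun a b : R => b <= a) l) l by rewrite perm_sort.
rewrite -(seq.permP sp) => {sp}.
have : sorted (fun a b : R => b <= a) (sort (fun a b : R => b <= a) l).
  by apply: sort_sorted => x y; rewrite orbC; exact: le_total.
elim: (sort _ _) k => [|x s IH] k //=; first by rewrite nth_nil t0.
rewrite path_sortedE; last by move=> ? ? ? h1 h2; exact: le_trans h2 h1.
move=> /andP[xs ss]; have [xt|xt] := leP x t.
  rewrite add0n (eq_in_count (a2 := pred0)) ?count_pred0 => [|y /(allP xs) yx]; last first.
    by rewrite ltNge (le_trans yx xt).
  case: k => [|k]; first by rewrite xt.
  rewrite /= IH// (eq_in_count (a2 := pred0)) ?count_pred0// => y /(allP xs) yx.
  by rewrite ltNge (le_trans yx xt).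
case: k => [|k]; first by rewrite /= leNgt xt.
by rewrite /= IH// add1n ltnS.
Qed.

Lemma decr_rearr_fin_le (s : seq C) (t : R) k : 0 <= t ->
  (decr_rearr_fin s k <= t) = (count (fun z => (t < cabs z)%R) s <= k)%N.
Proof. by move=> t0; rewrite /decr_rearr_fin nth_sort_ge_le// count_map. Qed.

Lemma decr_rearr_fin_ge0 (s : seq C) k : 0 <= decr_rearr_fin s k.
Proof.
rewrite /decr_rearr_fin; set l := sort _ _.
have [kl|kl] := ltnP k (size l); last by rewrite nth_default.
have := mem_nth 0 kl; rewrite mem_sort => /mapP[z _ ->]; exact: cabs_ge0.
Qed.

Lemma decr_rearr_fin_oversize (s : seq C) k : (size s <= k)%N -> decr_rearr_fin s k = 0.
Proof. by move=> sk; rewrite /decr_rearr_fin nth_default// size_sort size_map. Qed.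

Lemma decr_rearr_fin_homo (s : seq C) k l : (k <= l)%N ->
  decr_rearr_fin s l <= decr_rearr_fin s k.
Proof.
move=> kl; rewrite decr_rearr_fin_le ?decr_rearr_fin_ge0//; apply: leq_trans kl.
by rewrite -decr_rearr_fin_le ?decr_rearr_fin_ge0.
Qed.

Lemma decr_rearr_ge0 (x : nat -> C) k : (0 <= decr_rearr x k)%E.
Proof. by apply: le_ereal_inf_tmp => _ [l [l0 _] <-]; rewrite lee_fin. Qed.

Lemma atleast_mono (f g : nat -> R) l n :
  (forall i, f i <= g i) -> atleast f l n -> atleast g l n.
Proof.
move=> fg [s [us ss /allP sl]]; exists s; split => //; apply/allP => i /sl.
by move=> h; exact: lt_le_trans (fg i).
Qed.

Lemma decr_rearr_mono (x y : nat -> C) k :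
  (forall i, cabs (x i) <= cabs (y i)) -> (decr_rearr x k <= decr_rearr y k)%E.
Proof.
move=> xy; apply: ereal_inf_le_tmp => _ [l [l0 h] <-]; exists l => //; split => //.
by apply: contra_not h; exact: atleast_mono.
Qed.

(** Indices with a value above [decr_rearr_fin s k] are among the first [k], so this value is
    admissible in the infimum. *)
Lemma decr_rearr_of_fin (s : seq C) k :
  (decr_rearr (fun i => (decr_rearr_fin s i)%:C%C) k <= (decr_rearr_fin s k)%:E)%E.
Proof.
apply: ereal_inf_lbound; exists (decr_rearr_fin s k) => //.
split; first exact: decr_rearr_fin_ge0.
move=> [l [ul sl /allP al]].
have : (size l <= size (iota 0 k))%N.
  apply: uniq_leq_size => // i /al; rewrite cabs_real ger0_norm ?decr_rearr_fin_ge0//.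
  rewrite mem_iota /= add0n ltnNge; apply: contraTN => ki.
  by rewrite -leNgt decr_rearr_fin_homo.
by rewrite sl size_iota ltnn.
Qed.

Lemma lorentz_term_ge0 p (x : nat -> C) k : 0 <= p ->
  (0 <= decr_rearr x k * (lorentz_weight p k)%:E)%E.
Proof. by move=> p0; rewrite mule_ge0 ?decr_rearr_ge0// lee_fin lorentz_weight_ge0. Qed.

Lemma lorentz_p1_norm_le p (x : nat -> C) (B : \bar R) : 0 <= p ->
  (forall N, (\sum_(0 <= k < N) decr_rearr x k * (lorentz_weight p k)%:E <= B)%E) ->
  (lorentz_p1_norm p x <= B)%E.
Proof.
move=> p0 H; apply: lime_le; last by apply: nearW.
by apply: is_cvg_nneseries => k _ _; exact: lorentz_term_ge0.
Qed.

Lemma lorentz_p1_norm_ge p (x : nat -> C) N : 0 <= p ->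
  (\sum_(0 <= k < N) decr_rearr x k * (lorentz_weight p k)%:E <= lorentz_p1_norm p x)%E.
Proof. by move=> p0; apply: nneseries_lim_ge => k _ _; exact: lorentz_term_ge0. Qed.

Lemma lorentz_p1_norm_mono p (x y : nat -> C) : 0 <= p ->
  (forall i, cabs (x i) <= cabs (y i)) -> (lorentz_p1_norm p x <= lorentz_p1_norm p y)%E.
Proof.
move=> p0 xy; apply: lee_nneseries => k *; first exact: lorentz_term_ge0.
by apply: lee_wpmul2r; rewrite ?decr_rearr_mono// lee_fin lorentz_weight_ge0.
Qed.

Lemma normX_fin_lorentz_le p (s : seq C) : 0 <= p ->
  (normX_fin (@lorentz_p1_norm R p) s
     <= (\sum_(k < size s) decr_rearr_fin s k * lorentz_weight p k)%:E)%E.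
Proof.
move=> p0; apply: lorentz_p1_norm_le => // N.
pose F k := decr_rearr_fin s k * lorentz_weight p k.
have F0 k : 0 <= F k by rewrite mulr_ge0 ?decr_rearr_fin_ge0 ?lorentz_weight_ge0.
apply: (@le_trans _ _ (\sum_(0 <= k < N) (F k)%:E)%E).
  apply: lee_sum => k _; rewrite EFinM.
  by apply: lee_wpmul2r; rewrite ?decr_rearr_of_fin// lee_fin lorentz_weight_ge0.
rewrite sumEFin lee_fin -(big_mkord xpredT F).
have [Ns|sN] := leqP N (size s).
  by rewrite (big_cat_nat (leq0n _) Ns)/= lerDl sumr_ge0.
rewrite (big_cat_nat (leq0n _) (ltnW sN))/=.
rewrite -[leRHS]addr0 lerD2l big_nat_cond sumr_le0// => k /andP[/andP[sk _] _].
by rewrite /F decr_rearr_fin_oversize// mul0r.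
Qed.

(** The rank [r e] is the position of [e] in an enumeration by decreasing modulus. This turns a
    Lorentz sum over ranks into one over multi-indices. *)
Lemma decr_rearr_fin_enum (T : finType) (a : T -> C) : exists r : T -> nat,
  injective r /\ forall w : nat -> R,
    \sum_(k < #|T|) decr_rearr_fin [seq a e | e <- enum T] k * w k =
    \sum_e w (r e) * cabs (a e).
Proof.
pose es := sort (relpre (fun e => cabs (a e)) (fun x y : R => y <= x)) (enum T).
have es_all e : e \in es by rewrite mem_sort mem_enum.
have es_uniq : uniq es by rewrite sort_uniq enum_uniq.
have es_size : size es = #|T| by rewrite size_sort cardE.
exists (index^~ es); split.
  by move=> x y h; rewrite -(nth_index x (es_all x)) h nth_index.
move=> w.
have pe : perm_eq (index_enum T) es.
  by apply: uniq_perm => // [|e]; rewrite ?index_enum_uniq// es_all mem_index_enum.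
rewrite [RHS](perm_big _ pe) /=.
case: (pickP T) => [e0 _|T0]; last first.
  have -> : es = [::] by case: (es) => // e; have := T0 e.
  rewrite big_nil big1// => -[k] + _; rewrite -[#|T|]/(#|T|).
  by rewrite eq_card0.
rewrite (big_nth e0) es_size big_mkord; apply: eq_bigr => k _.
rewrite index_uniq ?es_size// mulrC; congr (_ * _).
rewrite /decr_rearr_fin.
have -> : sort (fun x y : R => y <= x) [seq cabs z | z <- [seq a e | e <- enum T]] =
    [seq cabs (a e) | e <- es] by rewrite -map_comp sort_map.
by rewrite (nth_map e0)// es_size.
Qed.

Lemma decr_rearr_fin_mono (s s' : seq C) k :
  (forall t, 0 <= t ->
     (count (fun z => (t < cabs z)%R) s <= count (fun z => (t < cabs z)%R) s')%N) ->
  decr_rearr_fin s k <= decr_rearr_fin s' k.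
Proof.
move=> H; have t0 := decr_rearr_fin_ge0 s' k.
by rewrite decr_rearr_fin_le// (leq_trans (H _ t0))// -decr_rearr_fin_le.
Qed.

End Rearrangement.

(** * Finiteness of the Bohnenblust-Hille constants *)

Section BohnenblustHille.
Variables (R : realType) (m : nat).
Local Notation C := R[i].

(** The normalization [1 <= C0] is harmless: sup norms are nonnegative, so a constant may be
    increased by 1. *)
Lemma BH_mult_ltoo (N : (nat -> C) -> \bar R) :
  (BH_mult N m < +oo)%E <-> exists C0 : R, 0 <= C0 /\
    forall n (a : {ffun 'I_m -> 'I_n} -> C),
      (normX_fin N (mat_coefs a) <= (C0 * mult_sup_norm a)%:E)%E.
Proof.
split => [/ereal_inf_lt[_ [C0 [C1 H] <-] _]|[C0 [C1 H]]].
  by exists C0; split => //; exact: le_trans C1.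
apply: le_lt_trans (ltry (C0 + 1)); apply: ereal_inf_lbound; exists (C0 + 1) => //.
split; first by rewrite lerDr.
move=> n a; apply: (le_trans (H n a)); rewrite lee_fin ler_wpM2r ?mult_sup_norm_ge0//.
by rewrite lerDl.
Qed.

Lemma BH_pol_ltoo (N : (nat -> C) -> \bar R) :
  (BH_pol N m < +oo)%E <-> exists C0 : R, 0 <= C0 /\
    forall n (c : {ffun 'I_m -> 'I_n} -> C),
      (normX_fin N (pol_coefs c) <= (C0 * pol_sup_norm c)%:E)%E.
Proof.
split => [/ereal_inf_lt[_ [C0 [C1 H] <-] _]|[C0 [C1 H]]].
  by exists C0; split => //; exact: le_trans C1.
apply: le_lt_trans (ltry (C0 + 1)); apply: ereal_inf_lbound; exists (C0 + 1) => //.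
split; first by rewrite lerDr.
move=> n a; apply: (le_trans (H n a)); rewrite lee_fin ler_wpM2r//; last by rewrite lerDl.
apply: le_trans (cabs_ge0 _) (poly_le a (z := fun _ => 0) _) => k.
by rewrite cabs0.
Qed.

End BohnenblustHille.

Lemma BH_mult_lorentz (R : realType) (m : nat) : (0 < m)%N ->
  (BH_mult (@lorentz_p1_norm R ((2 * m%:R) / (m%:R + 1))) m < +oo)%E.
Proof.
case: m => // m _; apply/BH_mult_ltoo.
exists ((m.+1%:R + 1) * (m.+1%:R * 2 * 3 ^+ m)); split.
  by rewrite !mulr_ge0 ?addr_ge0 ?exprn_ge0.
move=> n a; have p0 := ltW (lorentz_exponent_gt0 R (ltn0Sn m)).
have [r [r_inj Hr]] := decr_rearr_fin_enum a.
apply: le_trans (normX_fin_lorentz_le _ p0) _.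
by rewrite lee_fin /mat_coefs size_map -cardE Hr mixed_norms_le.
Qed.

(** * Polarization *)

Section Polarization.
Variables (R : realType) (m n : nat).
Local Notation C := R[i].
Let E := {ffun 'I_m -> 'I_n}.

(** For a permutation [f] every sign occurs squared. Otherwise some [l] is outside the image of [f],
    its sign occurs exactly once, and flipping it shows that the sum is its own opposite. *)
Lemma sum_sign_prod (f : {ffun 'I_m -> 'I_m}) :
  \sum_(d : {ffun 'I_m -> bool}) \prod_k ((-1) ^+ d k * (-1) ^+ d (f k)) =
  (if injectiveb f then 2 ^+ m else 0) :> C.
Proof.
case: injectiveP => [f_inj|f_ninj].
  under eq_bigr => d _.
    rewrite big_split /= -(reindex_inj f_inj (P := xpredT) (F := fun k => (-1) ^+ d k)).
    rewrite /= -big_split /=.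
    under eq_bigr do rewrite -signr_addb addbb expr0.
    rewrite big1//.
    over.
  by rewrite sumr_const card_ffun card_bool card_ord -natrX.
have [l lf] : exists l, l \notin codom f.
  apply: contra_notP f_ninj => /forallNP lf.
  suff : {in predT &, injective f} by move=> h x y; exact: h.
  apply/image_injP/eqP/eq_card => l; have /negP := lf l; rewrite negbK.
  by move=> ->.
set S := \sum_d _.
pose flip (d : {ffun 'I_m -> bool}) := [ffun k => d k (+) (k == l)] : {ffun 'I_m -> bool}.
have flip_inv : involutive flip by move=> d; apply/ffunP => k; rewrite !ffunE addbK.
suff : S = - S.
  by move/eqP; rewrite -addr_eq0 -mulr2n mulrn_eq0 /= => /eqP.
rewrite {1}/S (reindex_inj (inv_inj flip_inv)) -sumrN; apply: eq_bigr => d _.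
rewrite (bigD1 l)//= [in RHS](bigD1 l)//= -mulNr; congr (_ * _).
  rewrite !ffunE eqxx addbT signrN mulNr; congr (- (_ * (-1) ^+ _)).
  by case: eqP => [fl|]; rewrite ?addbF//; move: lf; rewrite -fl codom_f.
apply: eq_bigr => k kl; rewrite !ffunE (negbTE kl) addbF.
by case: eqP => [fl|]; rewrite ?addbF//; move: lf; rewrite -fl codom_f.
Qed.

(** This is [m!] times the symmetric multilinear form of the polynomial; without the division,
    coefficients do not shrink. *)
Definition polar_form (c : E -> C) (x : 'I_m -> 'I_n -> C) : C :=
  \sum_(j : E | nondecr j) c j * \sum_(s : 'S_m) \prod_k x (s k) (j k).

(** Expand the product of sums over all maps [f] and sum over the signs first: by [sum_sign_prod]
    only the permutations survive. *)
Lemma polarization (c : E -> C) (x : 'I_m -> 'I_n -> C) :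
  \sum_(d : {ffun 'I_m -> bool}) (\prod_k (-1) ^+ d k) *
    \sum_(j : E | nondecr j) c j * \prod_k (\sum_l (-1) ^+ d l * x l (j k)) =
  2 ^+ m * polar_form c x.
Proof.
under eq_bigr do rewrite mulr_sumr.
rewrite exchange_big mulr_sumr; apply: eq_bigr => j _ /=.
under eq_bigr do rewrite mulrCA.
rewrite -mulr_sumr mulrCA; congr (_ * _).
under eq_bigr do rewrite bigA_distr_bigA mulr_sumr.
rewrite exchange_big /=.
transitivity (\sum_(f : {ffun 'I_m -> 'I_m})
    (\prod_k x (f k) (j k)) * (if injectiveb f then 2 ^+ m else 0)).
  apply: eq_bigr => f _; rewrite -sum_sign_prod mulr_sumr; apply: eq_bigr => d _.
  by rewrite !big_split /=; ring.
rewrite (bigID (fun f : {ffun 'I_m -> 'I_m} => injectiveb f)) /= addrC big1 ?add0r; last first.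
  by move=> f /negbTE ->; rewrite mulr0.
rewrite (reindex (@pval _)) /=; last first.
  pose in_Sn := insubd (1%g : 'S_m).
  by exists in_Sn => /= f Uf; first apply: val_inj; apply: insubdK.
rewrite mulr_sumr; apply: eq_big => /= [s | s _]; first by rewrite (valP s).
by rewrite (valP s) mulrC; congr (_ * _); apply: eq_bigr => k _; rewrite pvalE.
Qed.

Definition polar_coef (c : E -> C) (i : E) : C :=
  \sum_(j : E | nondecr j) \sum_(s : 'S_m | [ffun k => j (s k)] == i) c j.

Lemma polar_formE (c : E -> C) (x : 'I_m -> 'I_n -> C) :
  polar_form c x = \sum_i polar_coef c i * \prod_k x k (i k).
Proof.
under [RHS]eq_bigr do rewrite mulr_suml.
rewrite exchange_big; apply: eq_bigr => j _ /=.
under [RHS]eq_bigr do rewrite mulr_suml.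
rewrite (exchange_big_dep xpredT)//= mulr_sumr (reindex_inj invg_inj) /=.
apply: eq_bigr => s _.
rewrite (big_pred1 [ffun k => j (s k)]) => [|i]; last by rewrite /= eq_sym.
congr (_ * _).
rewrite (reindex_inj (@perm_inj _ s)) /=; apply: eq_bigr => k _.
by rewrite permK ffunE.
Qed.

(** Two sorted lists that are permutations of each other coincide. *)
Lemma nondecr_perm_eq (i j : E) (s : 'S_m) :
  nondecr i -> nondecr j -> [ffun k => j (s k)] = i -> j = i.
Proof.
have sorted_nondecr (e : E) : nondecr e -> sorted leq [seq val (e k) | k <- enum 'I_m].
  move=> /forallP ne; rewrite sorted_map.
  have : sorted (fun k l : 'I_m => (k <= l)%N) (enum 'I_m).
    by have := iota_sorted 0 m; rewrite -val_enum_ord sorted_map.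
  apply: sub_sorted => k l kl /=.
  by have /forallP/(_ l)/implyP := ne k; exact.
move=> /sorted_nondecr si /sorted_nondecr sj eji.
have /eq_in_map h : [seq val (j k) | k <- enum 'I_m] = [seq val (i k) | k <- enum 'I_m].
  apply: (sorted_eq leq_trans anti_leq) => //.
  have -> : [seq val (i k) | k <- enum 'I_m] =
      [seq val (j k) | k <- [seq s k | k <- enum 'I_m]].
    by rewrite -[RHS]map_comp; apply/eq_in_map => k _; rewrite /= -eji ffunE.
  apply/perm_map/uniq_perm => [||k]; rewrite ?enum_uniq//.
    by rewrite map_inj_uniq ?enum_uniq//; exact: perm_inj.
  rewrite mem_enum; apply/esym/mapP; exists ((s^-1)%g k); rewrite ?mem_enum//.
  by rewrite permKV.
by apply/ffunP => k; apply/val_inj/h; rewrite mem_enum.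
Qed.

(** At a nondecreasing [i] only [j = i] contributes, once for each permutation fixing [i], and the
    identity is one of them. *)
Lemma polar_coef_ge (c : E -> C) i : nondecr i -> cabs (c i) <= cabs (polar_coef c i).
Proof.
move=> ni; rewrite /polar_coef (bigD1 i)//= [X in _ + X]big1 ?addr0; last first.
  move=> j /andP[nj ji]; apply: big_pred0 => s; apply/negbTE; apply: contra ji.
  by move=> /eqP/(nondecr_perm_eq ni nj)->.
rewrite sumr_const -mulr_natr cabsM cabs_nat ler_peMr ?cabs_ge0// ler1n.
apply/card_gt0P; exists 1%g.
suff : [ffun k => i ((1%g : 'S_m) k)] == i by [].
by apply/eqP/ffunP => k; rewrite ffunE perm1.
Qed.

(** Each of the [2 ^ m] terms of [polarization] is, up to sign, the polynomial at a signed sum of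
    [m] vectors of the unit ball. Dividing this sum by [m] costs [m ^ m] by homogeneity. *)
Lemma polar_coef_norm_le (c : E -> C) : (0 < m)%N ->
  mult_sup_norm (polar_coef c) <= m%:R ^+ m * pol_sup_norm c.
Proof.
move=> m_gt0; apply: mult_sup_norm_le => x x1; rewrite -polar_formE.
have m0 : m%:R != 0 :> C by rewrite pnatr_eq0 -lt0n.
have c2 : cabs (2 ^+ m : C) = 2 ^+ m by rewrite -natrX cabs_nat natrX.
have two0 : 0 < 2 ^+ m :> R by rewrite exprn_gt0.
rewrite -(ler_pM2l two0) -{1}c2 -cabsM -polarization.
apply: (le_trans (cabs_sum _ _)).
have -> : 2 ^+ m * (m%:R ^+ m * pol_sup_norm c) =
    \sum_(d : {ffun 'I_m -> bool}) m%:R ^+ m * pol_sup_norm c.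
  by rewrite sumr_const card_ffun card_bool card_ord -[RHS]mulr_natl natrX.
apply: ler_sum => d _.
have sg1 k : cabs ((-1) ^+ d k : C) = 1 by case: (d k); rewrite ?expr0 ?expr1 ?cabsN cabs1.
rewrite cabsM cabs_prod (eq_bigr (fun=> 1)) ?big1_eq ?mul1r; last by move=> *; exact: sg1.
pose z t : C := m%:R^-1 * \sum_l (-1) ^+ d l * x l t.
have z1 t : cabs (z t) <= 1.
  have : cabs (m%:R * z t) <= m%:R.
    rewrite /z mulVKf//; apply: (le_trans (cabs_sum _ _)).
    rewrite -[X in _ <= X%:R](card_ord m) -sumr_const; apply: ler_sum => l _.
    by rewrite cabsM sg1 mul1r.
  by rewrite cabsM cabs_nat ger_pMr// ltr0n.
apply: le_trans (ler_wpM2l (exprn_ge0 m (ler0n R m)) (poly_le c z1)).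
have <- : cabs (m%:R ^+ m : C) = m%:R ^+ m by rewrite -natrX cabs_nat natrX.
rewrite -cabsM mulr_sumr le_eqVlt; apply/orP; left; apply/eqP; congr cabs.
apply: eq_bigr => j _; rewrite mulrCA; congr (_ * _).
rewrite -[X in _ ^+ X](card_ord m) -prodr_const -big_split /=.
by apply: eq_bigr => k _; rewrite mulVKf.
Qed.

End Polarization.

(** Stated for monotone [N], to serve both [lorentz_p1_norm] and a general symmetric space. *)
Lemma BH_mult_pol (R : realType) (m : nat) (N : (nat -> R[i]) -> \bar R) : (0 < m)%N ->
  (forall x y, (forall i, cabs (y i) <= cabs (x i)) -> (N y <= N x)%E) ->
  (BH_mult N m < +oo)%E -> (BH_pol N m < +oo)%E.
Proof.
move=> m_gt0 N_mono /BH_mult_ltoo[C0 [C0_ge0 H]]; apply/BH_pol_ltoo.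
exists (C0 * m%:R ^+ m); split; first by rewrite mulr_ge0 ?exprn_ge0.
move=> n c; apply: (@le_trans _ _ (C0 * mult_sup_norm (polar_coef c))%:E).
  apply: le_trans (H n (polar_coef c)); apply: N_mono => k.
  rewrite !cabs_real !ger0_norm ?decr_rearr_fin_ge0//; apply: decr_rearr_fin_mono => t t0.
  rewrite /pol_coefs /mat_coefs count_map count_filter [leqRHS]count_map.
  apply: sub_count => j /= /andP[tj nj].
  exact: lt_le_trans tj (polar_coef_ge c nj).
by rewrite lee_fin -mulrA ler_wpM2l// polar_coef_norm_le.
Qed.

(** * Flat polynomials *)

Section Hadamard.
Variable R : realType.
Local Notation C := R[i].

(** Sylvester's doubling, with blocks [H], [H], [H], [- H]. *)
Lemma hadamard_matrix k : exists H : 'M[R]_(2 ^ k),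
  (forall i j, is_sign (H i j)) /\ H^T *m H = (2 ^ k)%:R%:M.
Proof.
elim: k => [|k [H [H1 HH]]].
  rewrite expn0; exists 1%:M; split; last by rewrite trmx1 mul1mx.
  by move=> i j; rewrite !ord1 mxE eqxx /is_sign eqxx.
rewrite expnS mul2n -addnn; exists (block_mx H H H (- H)); split.
  have HN i j : is_sign ((- H) i j).
    by rewrite mxE /is_sign eqr_opp eqr_oppLR orbC; exact: H1.
  by move=> i j; rewrite !mxE; case: splitP => i' _; rewrite !mxE; case: splitP.
have HN : (- H)^T = - H^T by exact: linearN.
rewrite tr_block_mx mulmx_block HN !mulmxN !mulNmx opprK HH subrr.
by rewrite -raddfD -natrD -scalar_mx_block.
Qed.

(** The matrix is real, so it acts separately on the real and imaginary parts of [v]. *)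
Lemma hadamard_isometry k : exists H : 'I_(2 ^ k) -> 'I_(2 ^ k) -> R,
  (forall i j, is_sign (H i j)) /\
  forall v : 'I_(2 ^ k) -> C,
    \sum_i cabs (\sum_j (H i j)%:C%C * v j) ^+ 2 = (2 ^ k)%:R * \sum_j cabs (v j) ^+ 2.
Proof.
have [H [H1 HH]] := hadamard_matrix k; exists H; split => // v.
have Hreal (w : 'I_(2 ^ k) -> R) :
    \sum_i (\sum_j H i j * w j) ^+ 2 = (2 ^ k)%:R * \sum_j w j ^+ 2.
  pose W := \col_j w j.
  have : ((H *m W)^T *m (H *m W)) 0 0 = ((2 ^ k)%:R *: (W^T *m W)) 0 0.
    by rewrite trmx_mul mulmxA -(mulmxA W^T) HH mul_mx_scalar -scalemxAl.
  rewrite !mxE => e.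
  transitivity (\sum_j (H *m W)^T 0 j * (H *m W) j 0).
    apply: eq_bigr => i _; rewrite !mxE expr2; congr (_ * _);
      by apply: eq_bigr => j _; rewrite mxE.
  by rewrite e; congr (_ * _); apply: eq_bigr => j _; rewrite !mxE expr2.
under eq_bigr do rewrite cabs_sqr.
under [in RHS]eq_bigr do rewrite cabs_sqr.
rewrite !big_split /= mulrDr -!Hreal; congr (_ + _); apply: eq_bigr => i _; congr (_ ^+ 2).
  rewrite (big_morph (@complex.Re R) (id1 := 0) (op1 := +%R))//; last by case=> ? ? [].
  by apply: eq_bigr => j _; case: (v j) => x y /=; rewrite mul0r subr0.
rewrite (big_morph (@complex.Im R) (id1 := 0) (op1 := +%R))//; last by case=> ? ? [].
by apply: eq_bigr => j _; case: (v j) => x y /=; rewrite mul0r addr0.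
Qed.

(* The signs are the products [H (i 0) (i 1) * ... * H (i (m - 1)) (i m)]. *)
Lemma flat_signs k m : exists a : {ffun 'I_m.+1 -> 'I_(2 ^ k)} -> R,
  (forall i, is_sign (a i)) /\
  forall x : 'I_m.+1 -> 'I_(2 ^ k) -> C, (forall l j, cabs (x l j) <= 1) ->
    cabs (\sum_i (a i)%:C%C * \prod_l x l (i l)) ^+ 2 <= (2 ^ k)%:R ^+ m.+2.
Proof.
set n := (2 ^ k)%N.
(* [V m a x j] is the form with its first index frozen at [j] and the first variable removed. Its
   squared [l_2] norm in [j] is tracked by induction; a final Cauchy-Schwarz over [j] costs one more
   factor [n]. *)
pose V m (a : {ffun 'I_m.+1 -> 'I_n} -> R) (x : 'I_m.+1 -> 'I_n -> C) j :=
  \sum_(g : {ffun 'I_m -> 'I_n})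
     (a (ffun_insert ord0 j g))%:C%C * \prod_l x (lift ord0 l) (g l).
suff [a [a1 Va]] : exists a : {ffun 'I_m.+1 -> 'I_n} -> R, (forall i, is_sign (a i)) /\
    forall x, (forall l j, cabs (x l j) <= 1) ->
      \sum_j cabs (V m a x j) ^+ 2 <= n%:R ^+ m.+1.
  exists a; split => // x x1.
  have -> : \sum_i (a i)%:C%C * \prod_l x l (i l) = \sum_j x ord0 j * V m a x j.
    rewrite (big_ffun_insert ord0); apply: eq_bigr => j _; rewrite mulr_sumr.
    by apply: eq_bigr => g _; rewrite prod_ffun_insert mulrCA.
  apply: (@le_trans _ _ ((\sum_j 1 * cabs (V m a x j)) ^+ 2)).
    rewrite ler_pXn2r// ?nnegrE ?cabs_ge0//; last first.
      by rewrite sumr_ge0// => j _; rewrite mul1r cabs_ge0.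
    apply: (le_trans (cabs_sum _ _)); apply: ler_sum => j _.
    by rewrite cabsM ler_wpM2r ?cabs_ge0.
  apply: (le_trans (sqr_sum_le (fun=> 1) _)).
  have -> : \sum_(j < n) 1 ^+ 2 = n%:R :> R by rewrite expr1n sumr_const card_ord.
  by rewrite [leRHS]exprS ler_wpM2l// Va.
have [H [H1 HI]] := hadamard_isometry k.
elim: m => [|m [a [a1 Va]]].
  exists (fun=> 1); split; first by move=> *; rewrite /is_sign eqxx.
  move=> x x1; rewrite /V expr1.
  pose g0 : {ffun 'I_0 -> 'I_n} := ffun0 (card_ord 0).
  have u (F : {ffun 'I_0 -> 'I_n} -> C) : \sum_g F g = F g0.
    rewrite (bigD1 g0)//= big1 ?addr0// => g /eqP; case.
    by apply/ffunP => -[].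
  under eq_bigr do rewrite u big_ord0 mulr1 cabs1 expr1n.
  by rewrite sumr_const card_ord.
pose tail (f : {ffun 'I_m.+2 -> 'I_n}) : {ffun 'I_m.+1 -> 'I_n} := [ffun l => f (lift ord0 l)].
have tail_insert j g : tail (ffun_insert ord0 j g) = g.
  by apply/ffunP => l; rewrite ffunE ffun_insert_lift.
pose a' (f : {ffun 'I_m.+2 -> 'I_n}) := H (f ord0) (f (lift ord0 ord0)) * a (tail f).
exists a'; split.
  move=> f; rewrite /a'; have := H1 (f ord0) (f (lift ord0 ord0)); have := a1 (tail f).
  by rewrite /is_sign => /orP[]/eqP-> /orP[]/eqP->; rewrite ?mulNr ?mulrN ?mul1r ?opprK eqxx ?orbT.
move=> x x1; pose y l := x (lift ord0 l).
(* The new vector is [H] applied to the old one times coordinates of modulus at most 1, so its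
   squared norm grows by at most the factor [n]. *)
have VE j : V m.+1 a' x j =
    \sum_l (H j l)%:C%C * (y ord0 l * V m a y l).
  rewrite /V (big_ffun_insert ord0); apply: eq_bigr => l _.
  rewrite !mulr_sumr; apply: eq_bigr => g _.
  rewrite /a' tail_insert ffun_insert_id ffun_insert_lift ffun_insert_id rmorphM /=.
  by rewrite (prod_ffun_insert ord0 l g y); ring.
under eq_bigr do rewrite VE.
rewrite HI exprS ler_wpM2l//; apply: le_trans (Va y _); last by move=> *; exact: x1.
apply: ler_sum => j _; rewrite ler_pXn2r ?nnegrE ?cabs_ge0// cabsM.
by rewrite ler_piMl ?cabs_ge0// x1.
Qed.

End Hadamard.

(** * Growth of the fundamental function *)

Section FundamentalFunction.
Variable R : realType.
Local Notation C := R[i].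

(** Its norm, as a function of [M], is the fundamental function of the space. *)
Definition initial_segment (M : nat) : nat -> C := fun i => (i < M)%:R.

(* Giving each of the [m] arguments its own block of [n] variables turns the multilinear form
   into a polynomial with the same sup norm. *)
Lemma flat_polynomial k m : exists n (c : {ffun 'I_m.+1 -> 'I_n} -> C),
  pol_sup_norm c <= Num.sqrt ((2 ^ k)%:R ^+ m.+2) /\
  forall l, (l < (2 ^ k) ^ m.+1)%N -> 1 <= decr_rearr_fin (pol_coefs c) l.
Proof.
have [a [a1 Ha]] := flat_signs R k m.
set n := (2 ^ k)%N in a a1 Ha *.
have idx_lt (l : 'I_m.+1) (t : 'I_n) : (l * n + t < m.+1 * n)%N.
  by apply: (@leq_trans (l.+1 * n)%N); rewrite ?leq_mul2r ?ltn_ord ?orbT// mulSn addnC ltn_add2r.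
(* Variable [t] of block [l]. The blocks are consecutive, so one index from each block, in order,
   forms a nondecreasing multi-index. *)
pose idx l t := Ordinal (idx_lt l t).
pose emb (i : {ffun 'I_m.+1 -> 'I_n}) : {ffun 'I_m.+1 -> 'I_(m.+1 * n)} :=
  [ffun l => idx l (i l)].
have emb_inj : injective emb.
  move=> i i' /ffunP e; apply/ffunP => l; have := e l.
  by rewrite !ffunE => /(congr1 val)/addnI/val_inj.
have emb_nondecr i : nondecr (emb i).
  apply/forallP => l; apply/forallP => l'; apply/implyP.
  rewrite leq_eqVlt !ffunE /= => /orP[/eqP/val_inj->//|ll'].
  apply: (@leq_trans (l.+1 * n)%N); first by rewrite mulSn addnC leq_add2r ltnW.
  by apply: (@leq_trans (l' * n)%N); rewrite ?leq_addr// leq_mul2r ll' orbT.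
pose c j : C := \sum_(i | emb i == j) (a i)%:C%C.
have c_emb i : c (emb i) = (a i)%:C%C.
  by rewrite /c (big_pred1 i)// => i'; rewrite /= (inj_eq emb_inj).
exists (m.+1 * n)%N, c; split.
  apply: pol_sup_norm_le => z z1.
  have -> : \sum_(j : {ffun 'I_m.+1 -> 'I_(m.+1 * n)} | nondecr j) c j * \prod_l z (j l) =
      \sum_i (a i)%:C%C * \prod_l z (idx l (i l)).
    under eq_bigr do rewrite mulr_suml.
    rewrite (exchange_big_dep xpredT)//=; apply: eq_bigr => i _.
    rewrite (big_pred1 (emb i)).
      by congr (_ * _); apply: eq_bigr => l _; rewrite ffunE.
    by move=> j /=; rewrite eq_sym; case: eqP => [->|]; rewrite ?emb_nondecr ?andbF.
  rewrite -[leLHS]ger0_norm ?cabs_ge0// -sqrtr_sqr ler_sqrt ?exprn_ge0//.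
  exact: (Ha (fun l t => z (idx l t))).
(* If the value at [l] were below 1, all [n ^ m.+1] unimodular coefficients would exceed it, but at
   most [l] can. *)
move=> l ln; rewrite leNgt; apply/negP => lt1.
suff : ~~ (decr_rearr_fin (pol_coefs c) l <= decr_rearr_fin (pol_coefs c) l).
  by rewrite lexx.
rewrite decr_rearr_fin_le ?decr_rearr_fin_ge0// -ltnNge.
apply: (leq_trans ln).
rewrite -[X in (X ^ _)%N](card_ord n) -[X in (_ ^ X)%N](card_ord m.+1) -card_ffun cardE.
rewrite -(size_map emb) /pol_coefs count_map count_filter -size_filter.
apply: uniq_leq_size => [|j /mapP[i _ ->]].
  by rewrite map_inj_uniq// enum_uniq.
by rewrite mem_filter mem_enum andbT /= emb_nondecr andbT c_emb cabs_sign.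
Qed.

(** Test the inequality on [flat_polynomial]. The bound is [C0 * M ^ (1 / p)] for [M = 2 ^ (m * k)],
    as [powR_block] shows. *)
Lemma BH_pol_initial_segment m (N : (nat -> C) -> \bar R) : (0 < m)%N ->
  (forall x y, (forall i, cabs (y i) <= cabs (x i)) -> (N y <= N x)%E) ->
  (BH_pol N m < +oo)%E -> exists C0 : R, 0 <= C0 /\
  forall k, (N (initial_segment (2 ^ (m * k))) <= (C0 * Num.sqrt (2 ^+ m.+1) ^+ k)%:E)%E.
Proof.
case: m => // m _ N_mono /BH_pol_ltoo[C0 [C0_ge0 H]].
exists C0; split => // k.
have [n [c [c_norm c_ge1]]] := flat_polynomial k m.
apply: (@le_trans _ _ (normX_fin N (pol_coefs c))).
  apply: N_mono => l; rewrite cabs_nat cabs_real ger0_norm ?decr_rearr_fin_ge0//.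
  case: ltnP => [lm|_]; last exact: decr_rearr_fin_ge0.
  by apply: c_ge1; rewrite -expnM mulnC.
apply: (le_trans (H n c)); rewrite lee_fin ler_wpM2l//; apply: (le_trans c_norm).
have -> : Num.sqrt (2 ^+ m.+2) ^+ k = Num.sqrt ((2 ^ k)%:R ^+ m.+2) :> R.
  rewrite natrX -exprM mulnC exprM; set y := 2 ^+ m.+2.
  have y0 : 0 <= y :> R by rewrite exprn_ge0.
  by rewrite -{2}(sqr_sqrtr y0) -exprM mulnC exprM sqrtr_sqr ger0_norm// exprn_ge0 ?sqrtr_ge0.
exact: lexx.
Qed.

End FundamentalFunction.

(** * Embedding of the Lorentz space *)

Section DecreasingRearrangement.
Variable R : realType.
Local Notation C := R[i].
Implicit Type x : nat -> C.

Lemma atleast_leq (f : nat -> R) l n k : (n <= k)%N -> atleast f l k -> atleast f l n.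
Proof.
move=> nk [s [us ss /allP sl]]; exists (take n s); split.
- exact: take_uniq.
- by rewrite size_takel// ss.
- by apply/allP => i /mem_take/sl.
Qed.

Lemma decr_rearr_homo x k l : (k <= l)%N -> (decr_rearr x l <= decr_rearr x k)%E.
Proof.
move=> kl; apply: ereal_inf_le_tmp => _ [t [t0 h] <-]; exists t => //; split => //.
by apply: contra_not h; exact: atleast_leq.
Qed.

(** The infimum is attained: finitely many values above [t] have a minimum [u > t], so some
    admissible level lies below [u]. *)
Lemma not_atleast_decr_rearr x k (t : R) : decr_rearr x k = t%:E ->
  ~ atleast (fun i => cabs (x i)) t k.+1.
Proof.
move=> xk [s [us ss /allP st]].
pose u := \big[Num.min/t + 1]_(i <- s) cabs (x i).
have tu : t < u.
  rewrite /u big_seq; elim/big_ind: _ => [|a b ta tb|i /st//]; first by rewrite ltrDl.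
  by rewrite lt_min ta tb.
have : (decr_rearr x k < u%:E)%E by rewrite xk lte_fin.
move=> /ereal_inf_lt[_ [l [l0 h] <-]]; rewrite lte_fin => lu; apply: h.
exists s; split => //; apply/allP => i si; apply: lt_le_trans lu _.
rewrite /u; elim: s si {us ss st u tu} => //= j s IH.
by rewrite big_cons in_cons ge_min => /predU1P[->|/IH->]; rewrite ?lexx ?orbT.
Qed.

Lemma cabs_le_decr_rearr0 x (t : R) i : decr_rearr x 0 = t%:E -> cabs (x i) <= t.
Proof.
move=> /not_atleast_decr_rearr h; rewrite leNgt; apply/negP => ti; apply: h.
by exists [:: i]; rewrite /= ti.
Qed.

Lemma lorentz_weight_gt0 p k : 0 < p -> 0 < lorentz_weight p k :> R.
Proof.
move=> p0; rewrite subr_gt0 gt0_ltr_powR ?nnegrE ?invr_gt0//.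
by rewrite ltr_nat.
Qed.

(** An infinite value, multiplied by a positive weight, would make the Lorentz norm infinite. *)
Lemma decr_rearr_fin_num p x k : 0 < p -> (lorentz_p1_norm p x < +oo)%E ->
  decr_rearr x k \is a fin_num.
Proof.
move=> p0 x_lt; have x0 := decr_rearr_ge0 x k; rewrite ge0_fin_numE// ltey.
apply/eqP => xk; move: x_lt; apply/negP; rewrite -leNgt.
apply: le_trans (lorentz_p1_norm_ge x k.+1 (ltW p0)).
rewrite big_nat_recr//= xk gt0_mulye ?lte_fin ?lorentz_weight_gt0//.
rewrite addey// -ltNye; apply: lt_le_trans (_ : (0 <= _)%E); first exact: ltNy0.
by rewrite sume_ge0// => j _; rewrite lorentz_term_ge0// ltW.
Qed.

Section Blocks.
Variable m : nat.
Hypothesis m_gt0 : (0 < m)%N.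
Let p : R := (2 * m%:R) / (m%:R + 1).
Let D : R := Num.sqrt (2 ^+ m.+1).
Variables (x : nat -> C) (t : nat -> R).
Hypothesis xt : forall k, decr_rearr x k = (t k)%:E.

Lemma block_ratio_ge2 : 2 <= D.
Proof.
rewrite -[leLHS]ger0_norm// -sqrtr_sqr ler_sqrt ?exprn_ge0//.
by rewrite ler_eXn2l// ltr1n.
Qed.

Lemma powR_block k : (2 ^ (m * k))%:R `^ p^-1 = D ^+ k.
Proof.
have m0 : m%:R != 0 :> R by rewrite pnatr_eq0 -lt0n.
have powE (a : R) : 0 <= a -> (a ^+ (m * k)) `^ p^-1 = Num.sqrt (a ^+ m.+1) ^+ k.
  move=> a0; rewrite /p (lorentz_exponentV R m_gt0) -powR12_sqrt ?exprn_ge0//.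
  rewrite -[RHS]powR_mulrn ?powR_ge0// -!powRrM -(powR_mulrn _ a0).
  rewrite -[in RHS](powR_mulrn _ a0) -!powRrM; congr (_ `^ _).
  by rewrite natrM -natr1; field.
by rewrite natrX powE.
Qed.

Lemma sum_lorentz_weight a b : (a <= b)%N ->
  \sum_(a <= j < b) lorentz_weight p j = b%:R `^ p^-1 - a%:R `^ p^-1.
Proof. by move=> ab; rewrite (telescope_sumr (fun j => j%:R `^ p^-1)). Qed.

(** On each block of indices between consecutive powers of [2 ^ m], replace [t j] by its value at
    the right end; the weights of the block telescope to [D ^+ k.+1 - D ^+ k]. Index 0 stands
    alone. *)
Lemma rearr_block_le K :
  t 0 + \sum_(k < K) t (2 ^ (m * k.+1)) * (D ^+ k.+1 - D ^+ k) <=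
  \sum_(0 <= j < 2 ^ (m * K)) t j * lorentz_weight p j.
Proof.
have pV0 : p^-1 != 0 by rewrite invr_neq0// gt_eqF// lorentz_exponent_gt0.
elim: K => [|K IH].
  by rewrite big_ord0 addr0 muln0 expn0 big_nat1 /lorentz_weight powR1 powR0// subr0 mulr1.
have le2 : (2 ^ (m * K) <= 2 ^ (m * K.+1))%N by rewrite leq_exp2l// leq_mul2l leqnSn orbT.
rewrite big_ord_recr /= addrA (big_cat_nat (leq0n _) le2) /= lerD//.
rewrite -!powR_block -sum_lorentz_weight// mulr_sumr.
apply: ler_sum_nat => j /andP[_ jK]; rewrite ler_wpM2r//.
  by rewrite lorentz_weight_ge0// ltW// lorentz_exponent_gt0.
by rewrite -lee_fin -!xt decr_rearr_homo// ltnW.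
Qed.

(** The left end of a block is the right end of the previous one; this shift costs a factor [D].
    Since [D >= 2], [D ^+ k.+1] is at most twice [D ^+ k.+1 - D ^+ k], and [rearr_block_le]
    applies. *)
Lemma dyadic_sum_le (L : R) K : (lorentz_p1_norm p x = L%:E)%E ->
  \sum_(k < K) t (2 ^ (m * k)) * D ^+ k.+1 <= 3 * D * L.
Proof.
move=> xL; have D2 := block_ratio_ge2.
have t_ge0 k : 0 <= t k by rewrite -lee_fin -xt decr_rearr_ge0.
have h : t 0 + \sum_(k < K) t (2 ^ (m * k.+1)) * (D ^+ k.+1 - D ^+ k) <= L.
  apply: (le_trans (rearr_block_le K)); rewrite -lee_fin -xL -sumEFin.
  under eq_bigr do rewrite EFinM -xt.
  exact: lorentz_p1_norm_ge (ltW (lorentz_exponent_gt0 _ m_gt0)).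
have t1 : t (2 ^ (m * 0)) <= t 0 by rewrite -lee_fin -!xt decr_rearr_homo.
have D0 : 0 <= D by lra.
apply: (@le_trans _ _ (\sum_(k < K.+1) t (2 ^ (m * k)) * D ^+ k.+1)).
  by rewrite big_ord_recr /= lerDl mulr_ge0 ?exprn_ge0.
rewrite big_ord_recl /= expr1.
have -> : \sum_(i < K) t (2 ^ (m * bump 0 i)) * D ^+ (bump 0 i).+1 =
    D * \sum_(k < K) t (2 ^ (m * k.+1)) * D ^+ k.+1.
  rewrite mulr_sumr; apply: eq_bigr => k _; rewrite /bump leq0n add1n [in LHS]exprS; ring.
have h2 : \sum_(k < K) t (2 ^ (m * k.+1)) * D ^+ k.+1 <=
    2 * \sum_(k < K) t (2 ^ (m * k.+1)) * (D ^+ k.+1 - D ^+ k).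
  rewrite mulr_sumr; apply: ler_sum => k _; rewrite mulrCA ler_wpM2l// exprS.
  have := exprn_ge0 k D0; nra.
have h3 : t (2 ^ (m * 0)) + \sum_(k < K) t (2 ^ (m * k.+1)) * D ^+ k.+1 <= 3 * L.
  have s0 : 0 <= \sum_(k < K) t (2 ^ (m * k.+1)) * (D ^+ k.+1 - D ^+ k).
    apply: sumr_ge0 => k _; rewrite mulr_ge0// exprS; have := exprn_ge0 k D0; nra.
  have := t_ge0 0%N; lra.
have := ler_wpM2l D0 h3; lra.
Qed.

End Blocks.

End DecreasingRearrangement.

(** * Truncations and completeness in a symmetric space *)

Section SymmetricSpaces.
Variables (R : realType) (N : (nat -> R[i]) -> \bar R).
Local Notation C := R[i].
Hypothesis N_sym : symmetric_banach_seq_space N.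

Let N_ge0 x : (0 <= N x)%E. Proof. by case: N_sym. Qed.
Let N_eq0 x : N x = 0%E -> forall i, x i = 0. Proof. by case: N_sym => _ [h _]; exact: h. Qed.
Let NZ (c : C) x : N (fun i => c * x i) = ((cabs c)%:E * N x)%E.
Proof. by case: N_sym => _ [_ [h _]]; exact: h. Qed.
Let ND (x y : nat -> C) : (N (fun i => (x i + y i)%R) <= N x + N y)%E.
Proof. by case: N_sym => _ [_ [_ [h _]]]; exact: h. Qed.
Let N_mono (x y : nat -> C) : (forall i, cabs (y i) <= cabs (x i)) -> (N y <= N x)%E.
Proof. by case: N_sym => _ [_ [_ [_ [h _]]]]; exact: h. Qed.
Let N_equi (x y : nat -> C) : (N x < +oo)%E -> equidistributed x y -> N y = N x.
Proof. by case: N_sym => _ [_ [_ [_ [_ [_ h]]]]]; exact: h. Qed.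
Let N_complete (u : nat -> nat -> C) :
  (forall k, (N (u k) < +oo)%E) ->
  (forall e : R, 0 < e -> exists K, forall k l, (K <= k)%N -> (K <= l)%N ->
     (N (fun i => (u k i - u l i)%R) < e%:E)%E) ->
  exists x : nat -> C, (N x < +oo)%E /\
    (forall e : R, 0 < e -> exists K, forall k, (K <= k)%N ->
       (N (fun i => (u k i - x i)%R) < e%:E)%E).
Proof. by case: N_sym => _ [_ [_ [_ [_ [h _]]]]]; exact: h. Qed.

Let N_congr (x y : nat -> C) : (forall i, cabs (x i) = cabs (y i)) -> N x = N y.
Proof. by move=> xy; apply/eqP; rewrite eq_le !N_mono// => i; rewrite xy. Qed.

Let N0 : N (fun=> 0) = 0%E.
Proof.
have := NZ 0 (fun=> 0); rewrite cabs0 mul0e => <-.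
by apply: N_congr => i; rewrite mul0r.
Qed.

Let NB (x y : nat -> C) : N (fun i => x i - y i) = N (fun i => y i - x i).
Proof. by apply: N_congr => i; rewrite -cabsN opprB. Qed.

Lemma atleast_indicator (P : pred nat) (s : seq nat) l n : uniq s -> P =i s -> 0 < l ->
  atleast (fun i => cabs ((P i)%:R : C)) l n <-> n = 0%N \/ (l < 1 /\ (n <= size s)%N).
Proof.
move=> us Ps l0; split.
  move=> [t [ut <- /allP tl]].
  have tP i : i \in t -> P i /\ l < 1.
    by move=> /tl; rewrite cabs_nat; case: (P i) => // /(lt_trans l0); rewrite ltxx.
  case: t ut tl tP => [|i t] ut tl tP; [by left|right].
  split; first by have [] := tP i (mem_head _ _).
  by apply: uniq_leq_size => // j /tP[Pj _]; rewrite -Ps.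
move=> [->|[l1 ns]]; first by exists [::].
exists (take n s); split; rewrite ?take_uniq ?size_takel//.
apply/allP => i /mem_take; rewrite -Ps => Pi.
by rewrite cabs_nat (Pi : P i = true).
Qed.

Lemma finite_support_seq (y : nat -> C) M : ~ atleast (fun i => cabs (y i)) 0 M.+1 ->
  exists s : seq nat, [/\ uniq s, (size s <= M)%N & forall i, y i != 0 -> i \in s].
Proof.
(* A list of distinct support points of maximal length [n] exhausts the support. *)
move=> yM; have [n [[s [us ss /allP sy]] yn]] : exists n, atleast (fun i => cabs (y i)) 0 n /\
    ~ atleast (fun i => cabs (y i)) 0 n.+1.
  elim: M yM => [|M IH] yM; first by exists 0%N; split => //; exists [::].
  by case: (pselect (atleast (fun i => cabs (y i)) 0 M.+1)) => [|/IH//]; exists M.+1.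
exists s; split => //.
  rewrite ss leqNgt; apply/negP => Mn; apply: yM.
  by apply: atleast_leq Mn _; exists s; split => //; apply/allP.
move=> i yi; apply/negPn/negP => si; apply: yn; exists (i :: s); split => /=.
- by rewrite si.
- by rewrite ss.
- by rewrite lt_def cabs_eq0 yi cabs_ge0/=; apply/allP.
Qed.

(** Such a [y] is dominated by [b] times the indicator of its support, which is equidistributed with
    an initial segment of length at most [M]. *)
Lemma norm_le_initial_segment (y : nat -> C) (b : R) M : 0 <= b ->
  (N (initial_segment R M) < +oo)%E -> (forall i, cabs (y i) <= b) ->
  ~ atleast (fun i => cabs (y i)) 0 M.+1 ->
  (N y <= b%:E * N (initial_segment R M))%E.
Proof.
move=> b0 M_lt yb /finite_support_seq[s [us sM ys]].
have n_le : (N (initial_segment R (size s)) <= N (initial_segment R M))%E.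
  apply: N_mono => i; rewrite !cabs_nat ler_nat.
  by case: ltnP => // /leq_trans/(_ sM)->.
apply: (@le_trans _ _ (b%:E * N (initial_segment R (size s)))%E); last first.
  by rewrite lee_wpmul2l// lee_fin.
have <- : N (fun i => (b%:C%C : C) * (i \in s)%:R) = (b%:E * N (initial_segment R (size s)))%E.
  rewrite NZ cabs_real ger0_norm//; congr (_ * _)%E.
  apply: N_equi; first exact: le_lt_trans M_lt.
  move=> l l0 n.
  have iotaE : (fun i => i < size s)%N =i iota 0 (size s) by move=> i; rewrite mem_iota.
  have h1 := atleast_indicator n (iota_uniq 0 (size s)) iotaE l0.
  have sE : (fun i => i \in s) =i s by [].
  have h2 := atleast_indicator n us sE l0.
  by rewrite size_iota in h1; exact: iff_trans h1 (iff_sym h2).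
apply: N_mono => i; rewrite cabsM cabs_real cabs_nat ger0_norm//.
by have [->|/ys->] := eqVneq (y i) 0; rewrite ?cabs0 ?mulr1// mulr_ge0.
Qed.

(** Truncate [x] at the levels [T K]. Consecutive truncations differ by a sequence bounded by [T K]
    with at most [2 ^ (m * K.+1)] nonzero terms, of norm at most [C0 * T K * D ^+ K.+1]. These
    bounds are summable by [dyadic_sum_le]. *)
Lemma lorentz_embedding m (C0 : R) (x : nat -> C) : (0 < m)%N -> 0 <= C0 ->
  (forall k, (N (initial_segment R (2 ^ (m * k))) <=
    (C0 * Num.sqrt (2 ^+ m.+1) ^+ k)%:E)%E) ->
  let p : R := (2 * m%:R) / (m%:R + 1) in (lorentz_p1_norm p x < +oo)%E ->
  (N x <= (C0 * (1 + 3 * Num.sqrt (2 ^+ m.+1)))%:E * lorentz_p1_norm p x)%E.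
Proof.
move=> m_gt0 C0_ge0; set D := Num.sqrt _ => N_seg p x_lt.
have p0 : 0 < p := lorentz_exponent_gt0 R m_gt0.
have Lor_ge0 : (0 <= lorentz_p1_norm p x)%E.
  by apply: nneseries_ge0 => k *; rewrite lorentz_term_ge0// ltW.
pose L := fine (lorentz_p1_norm p x).
have LE : lorentz_p1_norm p x = L%:E by rewrite fineK// ge0_fin_numE.
pose t k := fine (decr_rearr x k).
have xt k : decr_rearr x k = (t k)%:E by rewrite fineK// (decr_rearr_fin_num _ p0).
pose T k := t (2 ^ (m * k))%N.
pose S K := \sum_(k < K) T k * D ^+ k.+1.
have D2 : 2 <= D := block_ratio_ge2 R m_gt0.
have t_ge0 k : 0 <= t k by rewrite -lee_fin -xt decr_rearr_ge0.
have T_homo k l : (k <= l)%N -> T l <= T k.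
  move=> kl; rewrite -lee_fin -!xt decr_rearr_homo// leq_exp2l//.
  by rewrite leq_mul2l kl orbT.
have S_le K : S K <= 3 * D * L by exact: dyadic_sum_le.
have SS K : S K.+1 = S K + T K * D ^+ K.+1 by rewrite /S big_ord_recr.
have T_le_S K : T K <= S K.+1 - S K.
  have D1 : 1 <= D ^+ K.+1 by apply: exprn_ege1; lra.
  by rewrite SS addrAC subrr add0r ler_peMr// t_ge0.
have S_homo k l : (k <= l)%N -> S k <= S l.
  move=> /subnK <-; elim: (l - k)%N => // d IH; rewrite addSn.
  by apply: (le_trans IH); rewrite -subr_ge0; apply: le_trans (T_le_S _); exact: t_ge0.
have S_cauchy e : 0 < e -> exists K, forall k, (K <= k)%N -> S k - S K < e.
  move=> e0; have supS : has_sup (range S).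
    by split; [exists (S 0%N), 0%N | exists (3 * D * L) => _ [k _ <-]].
  have [_ [K _ <-] SK] := sup_adherent e0 supS; exists K => k _.
  have := sup_upper_bound supS (imageT S k); lra.
pose u K i : C := if T K < cabs (x i) then x i else 0.
(* At most [2 ^ (m * 0) = 1] index has modulus above [T 0]. *)
have N_u0 : (N (u 0%N) <= (C0 * t 0%N)%:E)%E.
  have seg_lt : (N (initial_segment R (2 ^ (m * 0))) < +oo)%E.
    by apply: le_lt_trans (N_seg 0%N) (ltry _).
  apply: le_trans (norm_le_initial_segment (t_ge0 0%N) seg_lt _ _) _.
  - move=> i; rewrite /u; case: ifP => _; rewrite ?cabs0//.
    exact: cabs_le_decr_rearr0.
  - apply: contra_not (not_atleast_decr_rearr (xt (2 ^ (m * 0))%N)).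
    move=> [s [us ss /allP sl]]; exists s; split => //; apply/allP => i /sl.
    by rewrite /u; case: ifP => // _; rewrite cabs0 ltxx.
  rewrite mulrC EFinM lee_wpmul2l ?lee_fin//.
  by apply: le_trans (N_seg 0%N) _; rewrite expr0 mulr1.
have N_step K : (N (fun i => u K.+1 i - u K i)%R <= (C0 * (S K.+1 - S K))%:E)%E.
  have seg_lt : (N (initial_segment R (2 ^ (m * K.+1))) < +oo)%E.
    by apply: le_lt_trans (N_seg K.+1) (ltry _).
  have uE i : cabs (u K.+1 i - u K i) =
      if (T K.+1 < cabs (x i)) && (cabs (x i) <= T K) then cabs (x i) else 0.
    rewrite /u; case: (ltP (T K) (cabs (x i))) => [lt|le].
      by rewrite (le_lt_trans (T_homo _ _ (leqnSn K)) lt) subrr cabs0.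
    by rewrite subr0 andbT; case: ifP; rewrite ?cabs0.
  apply: le_trans (norm_le_initial_segment (t_ge0 _ : 0 <= T K) seg_lt _ _) _.
  - by move=> i; rewrite uE; case: ifP => [/andP[]//|_]; exact: t_ge0.
  - apply: contra_not (not_atleast_decr_rearr (xt (2 ^ (m * K.+1))%N)).
    move=> [s [us ss /allP sl]]; exists s; split => //; apply/allP => i /sl.
    by rewrite uE; case: ifP => [/andP[]//|_]; rewrite ltxx.
  rewrite SS addrAC subrr add0r mulrCA EFinM lee_wpmul2l ?lee_fin//.
  exact: t_ge0.
have N_diff K l : (K <= l)%N -> (N (fun i => u l i - u K i)%R <= (C0 * (S l - S K))%:E)%E.
  move=> /subnK <-; elim: (l - K)%N => [|d IH].
    rewrite add0n subrr mulr0 (_ : (fun i => _) = fun=> 0) ?N0//.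
    by apply/funext => i; rewrite subrr.
  rewrite addSn; apply: (@le_trans _ _ (N (fun i => u (d + K).+1 i - u (d + K)%N i)%R +
      N (fun i => u (d + K)%N i - u K i)%R)%E).
    apply: le_trans (ND _ _); apply: N_mono => i.
    by rewrite addrA subrK.
  apply: le_trans (leeD (N_step _) IH) _.
  by rewrite -EFinD -mulrDr addrA subrK.
have N_u K : (N (u K) <= (C0 * (t 0%N + S K))%:E)%E.
  apply: (@le_trans _ _ (N (u 0%N) + N (fun i => u K i - u 0%N i)%R)%E).
    by apply: le_trans (ND _ _); apply: N_mono => i; rewrite addrC subrK.
  apply: le_trans (leeD N_u0 (N_diff 0%N K (leq0n K))) _.
  by rewrite -EFinD -mulrDr /S big_ord0 subr0.
have [|e e0|y [y_lt uy]] := N_complete (u := u).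
- by move=> k; apply: le_lt_trans (N_u k) (ltry _).
- have C1 : 0 < C0 + 1 by rewrite ltr_wpDl.
  have [K HK] := S_cauchy (e / (C0 + 1)) (divr_gt0 e0 C1); exists K.
  have main k l : (K <= l)%N -> (l <= k)%N -> (N (fun i => (u k i - u l i)%R) < e%:E)%E.
    move=> Kl lk; apply: le_lt_trans (N_diff l k lk) _; rewrite lte_fin.
    have := HK k (leq_trans Kl lk); rewrite ltr_pdivlMr//.
    have := S_homo K l Kl; have := S_homo l k lk; nra.
  move=> k l Kk Kl; have [lk|kl] := leqP l k; first exact: main.
  by rewrite NB; apply: main => //; exact: ltnW.
(* Norm convergence determines coordinates. Since [T k] becomes smaller than any nonzero
   [cabs (x i)], [u k i] is eventually [x i]; if [y i] differed, [N (u k - y)] would stay above the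
   norm of the nonzero one-point sequence [d]. *)
have yx : y = x.
  apply/funext => i; apply/eqP; rewrite eq_sym -subr_eq0; apply/negPn/negP => d0.
  have [K1 HK1] : exists K1, forall k, (K1 <= k)%N -> u k i = x i.
    have [xi0|xiN0] := eqVneq (x i) 0.
      by exists 0%N => k _; rewrite /u xi0; case: ifP.
    have xi_gt0 : 0 < cabs (x i) by rewrite lt_def cabs_eq0 xiN0 cabs_ge0.
    have [K HK] := S_cauchy _ xi_gt0; exists K => k Kk; rewrite /u.
    suff -> : T k < cabs (x i) by [].
    have := HK k.+1 (leqW Kk); have := S_homo K k Kk; have := T_le_S k; lra.
  pose d j : C := if j == i then x i - y i else 0.
  have Nd : (N d != 0)%E.
    apply/negP => /eqP/N_eq0/(_ i); rewrite /d eqxx => /eqP.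
    by rewrite (negbTE d0).
  have Nd_gt0 : (0 < N d)%E by rewrite lt_def Nd N_ge0.
  have [e e0 eN] : exists2 e, 0 < e & (e%:E <= N d)%E.
    by case: (N d) Nd_gt0 => [r|_|//]; [exists r | exists 1; rewrite ?leey].
  have [K2 HK2] := uy e e0.
  have := HK2 (maxn K1 K2) (leq_maxr _ _); apply/negP; rewrite -leNgt.
  apply: (le_trans eN); apply: N_mono => j; rewrite /d; case: eqP => [->|_].
    by rewrite HK1 ?leq_maxl.
  by rewrite cabs0 cabs_ge0.
have t0_le : t 0%N <= L.
  rewrite -lee_fin -LE; apply: le_trans (lorentz_p1_norm_ge x 1 (ltW p0)).
  rewrite big_nat1 xt -EFinM lee_fin /lorentz_weight powR1 powR0 ?subr0 ?mulr1//.
  by rewrite invr_neq0// gt_eqF.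
(* Up to [e], [N x] is at most [N (u K)], and [t 0 <= L] together with [S K <= 3 * D * L] gives the
   constant. *)
apply/lee_addgt0Pr => e e0; have [K HK] := uy e e0.
apply: (@le_trans _ _ (N (u K) + N (fun i => x i - u K i)%R)%E).
  by apply: le_trans (ND _ _); apply: N_mono => i; rewrite addrC subrK.
apply: leeD; last by rewrite NB -yx ltW// HK.
apply: le_trans (N_u K) _; rewrite LE -EFinM lee_fin -mulrA ler_wpM2l//.
have := S_le K; lra.
Qed.

End SymmetricSpaces.

(** Serves both minimality claims, since [BH_mult_pol] reduces the multilinear hypothesis to the
    polynomial one. *)
Lemma lorentz_smallest (R : realType) (m : nat) (N : (nat -> R[i]) -> \bar R) : (0 < m)%N ->
  symmetric_banach_seq_space N -> (BH_pol N m < +oo)%E ->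
  exists C : R, 0 < C /\
    forall x, (N x <= C%:E * lorentz_p1_norm ((2 * m%:R) / (m%:R + 1)) x)%E.
Proof.
move=> m_gt0 N_sym N_BH.
have N_mono : forall x y, (forall i, cabs (y i) <= cabs (x i)) -> (N y <= N x)%E.
  by case: N_sym => _ [_ [_ [_ [h _]]]].
have [C0 [C0_ge0 N_seg]] := BH_pol_initial_segment m_gt0 N_mono N_BH.
set p := _ / _; pose C1 := C0 * (1 + 3 * Num.sqrt (2 ^+ m.+1)).
have p0 : 0 <= p := ltW (lorentz_exponent_gt0 R m_gt0).
have C1_ge0 : 0 <= C1 by rewrite mulr_ge0// addr_ge0// mulr_ge0 ?sqrtr_ge0.
exists (C1 + 1); split; first by rewrite ltr_wpDl.
move=> x; have Lor_ge0 : (0 <= lorentz_p1_norm p x)%E.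
  by apply: nneseries_ge0 => k *; exact: lorentz_term_ge0.
(* Outside the Lorentz space the right-hand side is infinite, because the constant [C1 + 1] is
   positive. *)
have [x_lt|] := ltP (lorentz_p1_norm p x) +oo%E; last first.
  by rewrite leye_eq => /eqP ->; rewrite gt0_muley ?lte_fin ?ltr_wpDl// leey.
apply: le_trans (lorentz_embedding N_sym m_gt0 C0_ge0 N_seg x_lt) _.
by apply: lee_wpmul2r => //; rewrite lee_fin lerDl.
Qed.

Theorem theorem3p1 (R : realType) (m : nat) (hm : (0 < m)%N) :
  let p : R := (2 * m%:R) / (m%:R + 1) in
  [/\ (BH_mult (@lorentz_p1_norm R p) m < +oo)%E,
      (forall N : (nat -> R[i]) -> \bar R,
         symmetric_banach_seq_space N -> (BH_mult N m < +oo)%E ->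
         exists C : R, 0 < C /\
           forall x : nat -> R[i], (N x <= C%:E * lorentz_p1_norm p x)%E),
      (BH_pol (@lorentz_p1_norm R p) m < +oo)%E &
      (forall N : (nat -> R[i]) -> \bar R,
         symmetric_banach_seq_space N -> (BH_pol N m < +oo)%E ->
         exists C : R, 0 < C /\
           forall x : nat -> R[i], (N x <= C%:E * lorentz_p1_norm p x)%E)].
Proof.
move=> p; have p0 : 0 <= p := ltW (lorentz_exponent_gt0 R hm).
split; first exact: BH_mult_lorentz.
- move=> N N_sym N_BH; apply: (lorentz_smallest hm N_sym).
  apply: (BH_mult_pol hm _ N_BH).
  by case: N_sym => _ [_ [_ [_ [h _]]]].
- apply: (BH_mult_pol hm _ (BH_mult_lorentz R hm)) => x y xy.
  exact: lorentz_p1_norm_mono.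
- by move=> N; exact: lorentz_smallest.
Qed.
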